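(* For every integer $n \geq 2$ the homotopy braid group $\widehat{B}_n$ is linear. Moreover, for every $n \geq 2$ there exists a natural number $m$ such that there exists a faithful representation (injective group homomorphism) $\widehat{B}_n \longrightarrow GL_m(\mathbb{Z})$.
   Context: Notation: for elements $a,b$ of a group, $a^b = b^{-1}ab$ and $[a,b] = a^{-1}b^{-1}ab$. A group $G$ is called linear if it has a faithful representation into the general linear group $GL_m(k)$ for some $m$ and some field $k$. The braid group $B_n$, $n \geq 2$, is the group generated by $\sigma_1,\ldots,\sigma_{n-1}$ with defining relations $\sigma_i\sigma_{i+1}\sigma_i = \sigma_{i+1}\sigma_i\sigma_{i+1}$ for $i=1,\ldots,n-2$, and $\sigma_i\sigma_j=\sigma_j\sigma_i$ for $|i-j|\geq 2$. For $1 \le i<j\le n$ define elements $a_{ij}\in B_n$ by $a_{i,i+1}=\sigma_i^2$ and $a_{ij} = \sigma_{j-1}\sigma_{j-2}\cdots\sigma_{i+1}\,\sigma_i^2\,\sigma_{i+1}^{-1}\cdots\sigma_{j-2}^{-1}\sigma_{j-1}^{-1}$ for $i+1<j\leq n$ (these generate the pure braid group $P_n$). The homotopy braid group $\widehat{B}_n$ is the quotient of $B_n$ by the relations $[a_{ik}, a_{ik}^g]=1$ for all $1\leq i<k\leq n$ and all $g\in\langle a_{1k},a_{2k},\ldots,a_{k-1,k}\rangle$ (i.e. the quotient of $B_n$ by the normal closure of these elements). *)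

(* Defs.v *)
From HB Require Import structures.
From mathcomp Require Import all_boot all_order all_algebra.
From mathcomp Require Import boolp.

Set Implicit Arguments.
Unset Strict Implicit.
Unset Printing Implicit Defensive.

Local Open Scope quotient_scope.
Local Open Scope group_scope.

(* The group GL_m(R) of invertible matrices.  MathComp's {'GL_m[R]} is        *)
(* restricted to finite R.                                                    *)
Record GLmatrix (m : nat) (R : comUnitRingType) :=
  GLMatrix { GLmx :> 'M[R]_m; _ : GLmx \in unitmx }.

Section GLmatrixGroup.
Variables (m : nat) (R : comUnitRingType).

HB.instance Definition _ := [isSub for @GLmx m R].
HB.instance Definition _ := [Choice of GLmatrix m R by <:].

Implicit Types A B C : GLmatrix m R.

Lemma GLmxP A : (A : 'M_m) \in unitmx. Proof. exact: (valP A). Qed.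

Lemma GLone_subproof : ((1%:M)%R : 'M[R]_m) \in unitmx.
Proof. exact: unitmx1. Qed.

Lemma GLmul_subproof A B : (A *m B)%R \in unitmx.
Proof. by rewrite unitmx_mul !GLmxP. Qed.

Lemma GLinv_subproof A : invmx A \in unitmx.
Proof. by rewrite unitmx_inv GLmxP. Qed.

Definition GLone := GLMatrix GLone_subproof.
Definition GLmul A B := GLMatrix (GLmul_subproof A B).
Definition GLinv A := GLMatrix (GLinv_subproof A).

Lemma GLmulA : associative GLmul.
Proof. by move=> A B C; apply: val_inj; apply: mulmxA. Qed.

Lemma GLmul1 : left_id GLone GLmul.
Proof. by move=> A; apply: val_inj; apply: mul1mx. Qed.

Lemma GLmulr1 : right_id GLone GLmul.
Proof. by move=> A; apply: val_inj; apply: mulmx1. Qed.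

Lemma GLmulV : left_inverse GLone GLinv GLmul.
Proof. by move=> A; apply: val_inj; apply: mulVmx; apply: GLmxP. Qed.

Lemma GLmulrV : right_inverse GLone GLinv GLmul.
Proof. by move=> A; apply: val_inj; apply: mulmxV; apply: GLmxP. Qed.

HB.instance Definition _ :=
  isGroup.Build (GLmatrix m R) GLmulA GLmul1 GLmulr1 GLmulV GLmulrV.

End GLmatrixGroup.

Definition linear_group (G : groupType) : Prop :=
  exists (m : nat) (k : fieldType) (rho : {multiplicative G -> GLmatrix m k}),
    injective rho.

(* The letter (i, b) stands for the generator i if b = false, and for its     *)
(* inverse if b = true.                                                       *)
Definition word (I : Type) : Type := seq (I * bool).

Definition inv_letter (I : Type) (x : I * bool) : I * bool := (x.1, ~~ x.2).

Inductive word_eq (I : Type) : word I -> word I -> Prop :=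
| WordRefl u : word_eq u u
| WordSym u v : word_eq u v -> word_eq v u
| WordTrans u v w : word_eq u v -> word_eq v w -> word_eq u w
| WordCancel u x v : word_eq (u ++ x :: inv_letter x :: v) (u ++ v).

Section FreeGroup.
Variable I : choiceType.
Implicit Types u v w : word I.

Definition word_eqb : rel (word I) := fun u v => `[< word_eq u v >].

Lemma word_eqb_refl : reflexive word_eqb.
Proof. by move=> u; apply/asboolP/WordRefl. Qed.

Lemma word_eqb_sym : symmetric word_eqb.
Proof. by move=> u v; apply/asboolP/asboolP => /WordSym. Qed.

Lemma word_eqb_trans : transitive word_eqb.
Proof.
by move=> v u w /asboolP uv /asboolP vw; apply/asboolP/(WordTrans uv vw).
Qed.

Canonical word_equiv := EquivRel word_eqb
  word_eqb_refl word_eqb_sym word_eqb_trans.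

Definition free_group : Type := {eq_quot word_equiv}.

HB.instance Definition _ := Choice.on free_group.
HB.instance Definition _ := EqQuotient.on free_group.

Definition inv_word u : word I := rev (map (@inv_letter I) u).

Lemma inv_letterK : involutive (@inv_letter I).
Proof. by case=> i b; rewrite /inv_letter negbK. Qed.

Lemma inv_wordK : involutive inv_word.
Proof.
by move=> u; rewrite /inv_word map_rev revK -map_comp map_id_in // => x _;
   apply: inv_letterK.
Qed.

Lemma inv_word_cat u v : inv_word (u ++ v) = inv_word v ++ inv_word u.
Proof. by rewrite /inv_word map_cat rev_cat. Qed.

Lemma word_eq_cat2 p q u v : word_eq u v -> word_eq (p ++ u ++ q) (p ++ v ++ q).
Proof.
elim=> [w|w1 w2 _ /WordSym//|w1 w2 w3 _ h1 _ h2|w1 x w2].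
- exact: WordRefl.
- exact: WordTrans h1 h2.
- by have := WordCancel (p ++ w1) x (w2 ++ q); rewrite -!catA.
Qed.

Lemma word_eq_cat u u' v v' :
  word_eq u u' -> word_eq v v' -> word_eq (u ++ v) (u' ++ v').
Proof.
move=> /(word_eq_cat2 [::] v) /= h1 /(word_eq_cat2 u' [::]).
by rewrite !cats0; apply: WordTrans.
Qed.

Lemma word_eq_inv u v : word_eq u v -> word_eq (inv_word u) (inv_word v).
Proof.
elim=> [w|w1 w2 _ /WordSym//|w1 w2 w3 _ h1 _ h2|w1 x w2].
- exact: WordRefl.
- exact: WordTrans h1 h2.
- rewrite -(cat1s x) -(cat1s _ w2) !inv_word_cat -!catA.
  have := WordCancel (inv_word w2) x (inv_word w1).
  by rewrite -{1}[x]inv_letterK.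
Qed.

Lemma word_eq_mulV u : word_eq (u ++ inv_word u) [::].
Proof.
elim: u => [|x u IHu]; first exact: WordRefl.
rewrite -cat1s inv_word_cat -catA (catA u).
apply: WordTrans (word_eq_cat2 [:: x] (inv_word [:: x]) IHu) _.
exact: (WordCancel [::] x [::]).
Qed.

Definition free_one : free_group := \pi_free_group [::].
Definition free_mul (x y : free_group) : free_group :=
  \pi_free_group (repr x ++ repr y).
Definition free_inv (x : free_group) : free_group := \pi_free_group (inv_word (repr x)).

Lemma free_piP u v : \pi_free_group u = \pi_free_group v <-> word_eq u v.
Proof. by split=> [/eqmodP/asboolP//|uv]; apply/eqmodP/asboolP. Qed.

Lemma word_eq_repr u : word_eq (repr (\pi_free_group u)) u.
Proof. by apply/free_piP; rewrite reprK. Qed.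

Lemma free_mulE u v :
  free_mul (\pi_free_group u) (\pi_free_group v) = \pi_free_group (u ++ v).
Proof. by apply/free_piP/word_eq_cat; apply: word_eq_repr. Qed.

Lemma free_invE u : free_inv (\pi_free_group u) = \pi_free_group (inv_word u).
Proof. by apply/free_piP/word_eq_inv; apply: word_eq_repr. Qed.

Lemma free_mulA : associative free_mul.
Proof.
move=> x y z; rewrite -[x]reprK -[y]reprK -[z]reprK.
rewrite (free_mulE (repr y)) (free_mulE (repr x) (repr y)).
by rewrite (free_mulE _ (_ ++ _)) (free_mulE (_ ++ _)) catA.
Qed.

Lemma free_mul1 : left_id free_one free_mul.
Proof. by move=> x; rewrite -[x]reprK free_mulE. Qed.

Lemma free_mulr1 : right_id free_one free_mul.
Proof. by move=> x; rewrite -[x]reprK free_mulE cats0. Qed.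

Lemma free_mulrV : right_inverse free_one free_inv free_mul.
Proof.
move=> x; rewrite -[x]reprK free_invE free_mulE.
by apply/free_piP/word_eq_mulV.
Qed.

Lemma free_mulV : left_inverse free_one free_inv free_mul.
Proof.
move=> x; rewrite -[x]reprK free_invE free_mulE; apply/free_piP.
by rewrite -{2}[repr x]inv_wordK; apply: word_eq_mulV.
Qed.

HB.instance Definition _ := isGroup.Build free_group
  free_mulA free_mul1 free_mulr1 free_mulV free_mulrV.

Definition free_gen (i : I) : free_group := \pi_free_group [:: (i, false)].

End FreeGroup.

Inductive generated (G : groupType) (S : G -> Prop) : G -> Prop :=
| GenIn x : S x -> generated S x
| Gen1 : generated S 1
| GenM x y : generated S x -> generated S y -> generated S (x * y)
| GenV x : generated S x -> generated S x^-1.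

Inductive normal_closure (G : groupType) (S : G -> Prop) : G -> Prop :=
| NclIn x : S x -> normal_closure S x
| Ncl1 : normal_closure S 1
| NclM x y : normal_closure S x -> normal_closure S y -> normal_closure S (x * y)
| NclV x : normal_closure S x -> normal_closure S x^-1
| NclJ x y : normal_closure S x -> normal_closure S (x ^ y).

Section QuotientGroup.
Variables (G : groupType) (S : G -> Prop).
Implicit Types x y z : G.

Definition ncl_eqb : rel G := fun x y => `[< normal_closure S (x^-1 * y) >].

Lemma ncl_eqb_refl : reflexive ncl_eqb.
Proof. by move=> x; apply/asboolP; rewrite mulVg; apply: Ncl1. Qed.

Lemma ncl_eqb_sym : symmetric ncl_eqb.
Proof.
by move=> x y; apply/asboolP/asboolP => /NclV; rewrite invgM invgK.
Qed.

Lemma ncl_eqb_trans : transitive ncl_eqb.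
Proof.
move=> y x z /asboolP xy /asboolP yz; apply/asboolP.
by have := NclM xy yz; rewrite -mulgA mulVKg.
Qed.

Canonical ncl_equiv := EquivRel ncl_eqb ncl_eqb_refl ncl_eqb_sym ncl_eqb_trans.

(* The quotient of G by the normal closure of S. *)
Definition quotient_group : Type := {eq_quot ncl_equiv}.

HB.instance Definition _ := Choice.on quotient_group.
HB.instance Definition _ := EqQuotient.on quotient_group.

Lemma quo_piP x y :
  \pi_quotient_group x = \pi_quotient_group y <-> normal_closure S (x^-1 * y).
Proof. by split=> [/eqmodP/asboolP//|xy]; apply/eqmodP/asboolP. Qed.

Definition quo_one : quotient_group := \pi_quotient_group 1.
Definition quo_mul (a b : quotient_group) : quotient_group :=
  \pi_quotient_group (repr a * repr b).
Definition quo_inv (a : quotient_group) : quotient_group :=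
  \pi_quotient_group (repr a)^-1.

Lemma ncl_repr x : normal_closure S ((repr (\pi_quotient_group x))^-1 * x).
Proof. by apply/quo_piP; rewrite reprK. Qed.

Lemma quo_mulE x y :
  quo_mul (\pi_quotient_group x) (\pi_quotient_group y)
  = \pi_quotient_group (x * y).
Proof.
apply/quo_piP; set x' := repr _; set y' := repr _.
have := NclM (NclJ y' (ncl_repr x)) (ncl_repr y).
by rewrite conjgE invgM -!mulgA mulVKg.
Qed.

Lemma quo_invE x :
  quo_inv (\pi_quotient_group x) = \pi_quotient_group x^-1.
Proof.
apply/quo_piP; have := NclJ x^-1 (NclV (ncl_repr x)).
by rewrite conjgE !invgM !invgK !mulgA mulgV mul1g.
Qed.

Lemma quo_mulA : associative quo_mul.
Proof.
move=> a b c; rewrite -[a]reprK -[b]reprK -[c]reprK.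
rewrite (quo_mulE (repr b)) (quo_mulE (repr a) (repr b)).
by rewrite (quo_mulE _ (_ * _)) (quo_mulE (_ * _)) mulgA.
Qed.

Lemma quo_mul1 : left_id quo_one quo_mul.
Proof. by move=> a; rewrite -[a]reprK quo_mulE mul1g. Qed.

Lemma quo_mulr1 : right_id quo_one quo_mul.
Proof. by move=> a; rewrite -[a]reprK quo_mulE mulg1. Qed.

Lemma quo_mulV : left_inverse quo_one quo_inv quo_mul.
Proof. by move=> a; rewrite -[a]reprK quo_invE quo_mulE mulVg. Qed.

Lemma quo_mulrV : right_inverse quo_one quo_inv quo_mul.
Proof. by move=> a; rewrite -[a]reprK quo_invE quo_mulE mulgV. Qed.

HB.instance Definition _ := isGroup.Build quotient_group
  quo_mulA quo_mul1 quo_mulr1 quo_mulV quo_mulrV.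

End QuotientGroup.

(* Strands and generators are numbered from 0: the generator i : 'I_n.-1 is   *)
(* sigma_(i+1), and braid_a i j below is a_(i+1, j+1).                        *)
Inductive braid_relator (n : nat) : free_group 'I_n.-1 -> Prop :=
| BraidAdjacent (i j : 'I_n.-1) : j = i.+1 :> nat ->
    braid_relator (free_gen i * free_gen j * free_gen i
                   / (free_gen j * free_gen i * free_gen j))
| BraidFar (i j : 'I_n.-1) : (i.+2 <= j) || (j.+2 <= i) ->
    braid_relator (free_gen i * free_gen j / (free_gen j * free_gen i)).

Definition braid_group (n : nat) : groupType :=
  quotient_group (@braid_relator n).

(* The value 1 for k >= n.-1 is junk, never reached from braid_a i j with     *)
(* i < j < n.                                                                 *)
Definition sigma (n k : nat) : braid_group n :=
  if insub k is Some i then \pi_(quotient_group (@braid_relator n)) (free_gen i)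
  else 1.

Definition braid_a (n : nat) (i j : 'I_n) : braid_group n :=
  let c := \prod_(k <- rev (index_iota i.+1 j)) sigma n k in
  c * sigma n i ^+ 2 / c.

Inductive homotopy_relator (n : nat) : braid_group n -> Prop :=
| HomotopyRelator (i k : 'I_n) (g : braid_group n) : i < k ->
    generated (fun x => exists2 j : 'I_n, j < k & x = braid_a j k) g ->
    homotopy_relator [~ braid_a i k, braid_a i k ^ g].

Definition homotopy_braid_group (n : nat) : groupType :=
  quotient_group (@homotopy_relator n).

(* Main.v *)
(* The reduced Magnus ring R_n is the quotient of the free associative ring
   Z<X_0, ..., X_(n-1)> by the monomials with a repeated letter; it is a free
   Z-module of finite rank.  The braid group acts on it by the ring automorphisms
     s_i : X_i |-> X_(i+1),   X_(i+1) |-> X_i + [X_i, X_(i+1)],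
   which is Artin's action on x_i = 1 + X_i.  A pure generator a_ik differs from
   1 by an operator with values in the ideal I_ik spanned by the monomials
   containing both X_i and X_k, and vanishing on I_ik.  Hence the conjugates of
   a_ik by pure braids commute with each other, and the action factors through
   the homotopy braid group.
   Faithfulness is proved by combing.  A braid on the strands 0, ..., m is
   u h t_j, with u in U_m = <a_jm : j < m>, h a braid on the strands
   0, ..., m-1, and t_j = s_(m-1) ... s_j.  If it acts trivially, its value at
   X_j forces j = m and then u X_m = X_m.  On the coefficients of the monomials
   starting with X_m, the generator a_jm acts as left multiplication by 1 + X_j,
   so u = 1 follows from Magnus's theorem for reduced free groups: the normal
   closure of the last generator is abelian, generated by the commutators
   [a_k, a_i1, ..., a_ir] with distinct indices, whose Magnus expansions are
   separated by the coefficients of X_k X_i1 ... X_ir. *)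

Require Import Defs.
From HB Require Import structures.
From mathcomp Require Import all_boot all_order all_algebra.
From mathcomp Require Import zify ring.

Set Implicit Arguments.
Unset Strict Implicit.
Unset Printing Implicit Defensive.

Import GRing.Theory Num.Theory.
Local Open Scope ring_scope.
Local Open Scope quotient_scope.
Local Open Scope nat_scope.
Local Open Scope group_scope.

(** * Universal properties and generated subgroups *)

Section FreeLift.
Variables (I : choiceType) (H : groupType) (f : I -> H).

Definition letter_eval (x : I * bool) : H := if x.2 then (f x.1)^-1 else f x.1.

Definition word_eval (u : word I) : H := \prod_(x <- u) letter_eval x.

Lemma word_eval_eq u v : word_eq u v -> word_eval u = word_eval v.
Proof.
elim=> // [w1 w2 w3 _ -> //|w1 [i b] w2].
rewrite /word_eval !big_cat /= !big_cons /letter_eval /=.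
by case: b; rewrite /= ?mulKg ?mulVKg.
Qed.

Definition free_lift (x : free_group I) : H := word_eval (repr x).

Lemma free_lift_pi u : free_lift (\pi_(free_group I) u) = word_eval u.
Proof. exact/word_eval_eq/word_eq_repr. Qed.

Lemma free_lift_gen i : free_lift (free_gen i) = f i.
Proof. by rewrite free_lift_pi /word_eval big_seq1. Qed.

Lemma free_liftM : {morph free_lift : x y / x * y}.
Proof.
move=> x y; rewrite -[x]reprK -[y]reprK -[LHS]/(free_lift (free_mul _ _)).
by rewrite free_mulE !free_lift_pi /word_eval big_cat.
Qed.

Lemma free_lift1 : free_lift 1 = 1.
Proof. by rewrite free_lift_pi /word_eval big_nil. Qed.

HB.instance Definition _ := isMultiplicative.Build _ _ free_lift free_liftM.
HB.instance Definition _ :=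
  Multiplicative_isUMagmaMorphism.Build _ _ free_lift free_lift1.

End FreeLift.

Section QuotientLift.
Variables (G H : groupType) (S : G -> Prop) (f : UMagmaMorphism.type G H).

Definition quo_proj (x : G) : quotient_group S := \pi_(quotient_group S) x.

Lemma quo_projM : {morph quo_proj : x y / x * y}.
Proof. by move=> x y; rewrite /quo_proj -quo_mulE. Qed.

HB.instance Definition _ := isMultiplicative.Build _ _ quo_proj quo_projM.
HB.instance Definition _ :=
  Multiplicative_isUMagmaMorphism.Build _ _ quo_proj (erefl _).

Lemma quo_proj_repr (a : quotient_group S) : quo_proj (repr a) = a.
Proof. exact: reprK. Qed.

Lemma quo_proj_eq1 x : S x -> quo_proj x = 1.
Proof. by move=> Sx; apply/esym/quo_piP; rewrite invg1 mul1g; apply: NclIn. Qed.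

Hypothesis fS : forall x, S x -> f x = 1.

Lemma normal_closure_ker x : normal_closure S x -> f x = 1.
Proof.
elim=> {x} [x /fS//||x y _ fx _ fy|x _ fx|x y _ fx].
- exact: gmulf1.
- by rewrite gmulfM fx fy mulg1.
- by rewrite gmulfV fx invg1.
- by rewrite gmulfJ fx conj1g.
Qed.

Definition quo_lift of (forall x, S x -> f x = 1) :=
  fun a : quotient_group S => f (repr a).

Lemma quo_liftE x : quo_lift fS (quo_proj x) = f x.
Proof.
have /normal_closure_ker := ncl_repr S x.
by rewrite gmulfM gmulfV => /mulg1_eq; rewrite invgK.
Qed.

Lemma quo_liftM : {morph quo_lift fS : x y / x * y}.
Proof.
move=> a b; rewrite -[a]quo_proj_repr -[b]quo_proj_repr -quo_projM.
by rewrite !quo_liftE gmulfM.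
Qed.

Lemma quo_lift1 : quo_lift fS 1 = 1.
Proof. by rewrite -[1]/(quo_proj 1) quo_liftE gmulf1. Qed.

HB.instance Definition _ := isMultiplicative.Build _ _ (quo_lift fS) quo_liftM.
HB.instance Definition _ :=
  Multiplicative_isUMagmaMorphism.Build _ _ (quo_lift fS) quo_lift1.

End QuotientLift.

Section Generated.
Variable G : groupType.
Implicit Types (S T : G -> Prop) (x y z : G).

Lemma generated_sub S T x :
  (forall y, S y -> generated T y) -> generated S x -> generated T x.
Proof.
move=> ST; elim=> {x} [x /ST//||x y _ Tx _ Ty|x _ Tx].
- exact: Gen1.
- exact: GenM.
- exact: GenV.
Qed.

Lemma generatedW S T x :
  (forall y, S y -> T y) -> generated S x -> generated T x.
Proof. by move=> ST; apply: generated_sub => y /ST; apply: GenIn. Qed.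

Lemma generated_comm S x y :
  (forall z, S z -> commute x z) -> generated S y -> commute x y.
Proof.
move=> Sx; elim=> {y} [y /Sx//||y z _ xy _ xz|y _ xy].
- exact: commute1.
- exact: commuteM.
- exact: commuteV.
Qed.

Lemma generated_comm2 S x y :
    (forall z t, S z -> S t -> commute z t) ->
  generated S x -> generated S y -> commute x y.
Proof.
move=> SS Sx Sy; apply: generated_comm Sy => z Sz.
by apply/commute_sym; apply: generated_comm Sx => t St; apply: SS.
Qed.

Lemma generated_conj S T x y :
    (forall z, S z -> generated T (z ^ y)) -> generated S x ->
  generated T (x ^ y).
Proof.
move=> ST; elim=> {x} [x /ST//||x z _ Tx _ Tz|x _ Tx].
- by rewrite conj1g; apply: Gen1.
- by rewrite conjMg; apply: GenM.
- by rewrite conjVg; apply: GenV.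
Qed.

Lemma generated_norm S T x y :
    (forall z t, S z -> T t -> generated S (z ^ t)) ->
    (forall z t, S z -> T t -> generated S (z ^ t^-1)) ->
  generated S x -> generated T y -> generated S (x ^ y).
Proof.
move=> ST STV Sx Ty.
suff: generated S (x ^ y) /\ generated S (x ^ y^-1) by case.
elim: Ty x Sx => {y} [y Ty||y z _ IHy _ IHz|y _ IHy] x Sx.
- by split; apply: generated_conj Sx => z Sz; [apply: ST|apply: STV].
- by rewrite invg1 conjg1.
- rewrite invgM !conjgM; split.
  + by have [/IHz[]] := IHy _ Sx.
  + by have [_ /IHy[]] := IHz _ Sx.
- by rewrite invgK and_comm; apply: IHy.
Qed.

Lemma generated_mul S T x :
    (forall z t, S z -> T t -> generated S (z ^ t)) ->
    (forall z t, S z -> T t -> generated S (z ^ t^-1)) ->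
    generated (fun z => S z \/ T z) x ->
  exists y z, [/\ generated S y, generated T z & x = y * z].
Proof.
move=> ST STV; have nST := generated_norm ST STV.
elim=> {x} [x [Sx|Tx]||x y _ [a [b [Sa Tb ->]]] _ [c [d [Sc Td ->]]]|x _].
- by exists x, 1; rewrite mulg1; split => //; [apply: GenIn|apply: Gen1].
- by exists 1, x; rewrite mul1g; split => //; [apply: Gen1|apply: GenIn].
- by exists 1, 1; rewrite mul1g; split => //; apply: Gen1.
- exists (a * c ^ b^-1), (b * d); split.
  + by apply: GenM => //; apply: nST => //; apply: GenV.
  + exact: GenM.
  + by rewrite conjgE invgK !mulgA mulgVK.
- case=> a [b [Sa Tb ->]]; exists (a^-1 ^ b), b^-1; split.
  + by apply: nST => //; apply: GenV.
  + exact: GenV.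
  + by rewrite conjgE invgM -!mulgA mulgV mulg1.
Qed.

End Generated.

(** * Combing *)

Definition swapn i k := if k == i then i.+1 else if k == i.+1 then i else k.

Lemma swapnK i : involutive (swapn i).
Proof. by move=> k; rewrite /swapn; do !case: ifP; lia. Qed.

Section Combing.
Variables (G : groupType) (s : nat -> G) (r : nat).

Definition descent m j : G := \prod_(k <- rev (index_iota j m)) s k.
Definition pure_gen j m : G := descent m j.+1 * s j ^+ 2 / descent m j.+1.

Definition braid_sub m (x : G) := exists2 i, i < m & x = s i.
Definition pure_sub m (x : G) := exists2 j, j < m & x = pure_gen j m.

Lemma descent_nn m : descent m m = 1.
Proof. by rewrite /descent /index_iota subnn big_nil. Qed.

Lemma descentSl m j : j <= m -> descent m.+1 j = s m * descent m j.
Proof.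
by move=> jm; rewrite /descent /index_iota subSn // -addn1 iotaD subnKC // rev_cat big_cons.
Qed.

Lemma descentSr m j : j < m -> descent m j = descent m j.+1 * s j.
Proof.
move=> jm; rewrite /descent /index_iota -(subnSK jm) /=.
by rewrite rev_cons -cats1 big_cat big_seq1.
Qed.

Lemma descent_commute i m j :
  (forall k, j <= k < m -> commute (s i) (s k)) -> commute (s i) (descent m j).
Proof.
move=> sik; rewrite /descent big_seq; apply: commute_prod => k.
by rewrite mem_rev mem_index_iota => /sik.
Qed.

Hypothesis braid_adj : forall i, i.+1 < r ->
  s i * s i.+1 * s i = s i.+1 * s i * s i.+1.
Hypothesis braid_far : forall i j, i.+1 < j -> j < r -> commute (s i) (s j).

Lemma descent_far i m j : i.+1 < j -> m <= r -> commute (s i) (descent m j).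
Proof.
move=> ij mr; apply: descent_commute => k /andP[jk km].
by apply: braid_far; [apply: leq_trans jk|apply: leq_trans mr].
Qed.

Lemma descent_shift i m j : j <= i -> i.+1 < m -> m <= r ->
  s i * descent m j = descent m j * s i.+1.
Proof.
move=> ji; elim: m => // m IHm; rewrite ltnS leq_eqVlt => /predU1P[<-|im] mr.
  rewrite descentSl ?leqW // descentSl // !mulgA braid_adj // -!mulgA.
  congr (_ * (_ * _)); apply: descent_commute => k /andP[_ ki].
  by apply/commute_sym/braid_far => //; lia.
rewrite descentSl; last by lia.
by rewrite mulgA braid_far // -!mulgA IHm // ltnW.
Qed.

Lemma pure_genE j m : j < m -> pure_gen j m = descent m j * s j / descent m j.+1.
Proof. by move=> jm; rewrite (descentSr jm) /pure_gen expg2 !mulgA. Qed.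

Lemma pure_genJ j m : pure_gen j m = s j ^+ 2 ^ (descent m j.+1)^-1.
Proof. by rewrite conjgE invgK mulgA. Qed.

Lemma pure_gen_conj_succ j m : j.+1 < m -> m <= r ->
  pure_gen j m ^ (s j)^-1 = pure_gen j.+1 m.
Proof.
move=> jm mr; rewrite !pure_genJ (descentSr jm) -conjgM -invgM.
rewrite mulgA (descent_far _ mr) // -mulgA invgM conjgM; congr (_ ^ _).
rewrite conjXg; congr (_ ^+ 2); rewrite conjgE invgK.
by rewrite mulgA braid_adj ?(leq_trans jm) // -(mulgA (s j.+1)) mulgK.
Qed.

Lemma pure_gen_conj_pred j m : j.+1 < m -> m <= r ->
  pure_gen j.+1 m ^ (s j)^-1 = pure_gen j m ^ pure_gen j.+1 m.
Proof.
move=> jm mr; rewrite (pure_genJ j) !(pure_genJ j.+1) (descentSr jm).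
set x := s j; set y := s j.+1; set d := descent m j.+2.
have xd : commute x d by apply: descent_far.
have -> : (y ^+ 2 ^ d^-1) ^ x^-1 = (y ^+ 2 ^ x^-1) ^ d^-1.
  by rewrite -!conjgM -!invgM xd.
rewrite (invgM d) (conjgM _ y^-1) -conjJg; congr (_ ^ _).
rewrite !conjXg; congr (_ ^+ 2); rewrite -conjgM expg2 mulKg.
rewrite !conjgE invgK; apply: (@mulgI _ y); rewrite mulVKg; apply: (@mulIg _ x).
by rewrite !mulgA mulgVK braid_adj //; lia.
Qed.

Lemma pure_gen_conj_far i j m : i < m.-1 -> i != j -> i.+1 != j -> j < m ->
  m <= r -> pure_gen j m ^ (s i)^-1 = pure_gen j m.
Proof.
move=> im ij iSj jm mr; have [ltij|leji] := ltnP i j.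
  have ji : i.+1 < j by rewrite ltn_neqAle iSj.
  apply/conjg_fixP/commgP/commute_sym; rewrite pure_genJ conjgE invgK.
  apply/commute_sym/commuteV/commute_sym.
  apply: commuteM; last apply: commuteM; last apply: commuteV.
  - exact: descent_far (leqW ji) mr.
  - by apply: commuteX; apply: braid_far => //; apply: leq_trans mr.
  - exact: descent_far (leqW ji) mr.
rewrite pure_genJ -conjgM -invgM descent_shift //; try by lia.
rewrite invgM conjgM; congr (_ ^ _); apply/conjg_fixP/commgP/commuteV.
by apply/commute_sym/commuteX/commute_sym/braid_far; lia.
Qed.

Lemma pure_sub_conjV i m x : i < m.-1 -> m <= r -> pure_sub m x ->
  generated (pure_sub m) (x ^ (s i)^-1).
Proof.
move=> im mr [j jm ->].
have genP k : k < m -> generated (pure_sub m) (pure_gen k m).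
  by move=> km; apply: GenIn; exists k.
have im' : i.+1 < m by lia.
have [eij|ij] := eqVneq i j.
  by subst j; rewrite pure_gen_conj_succ //; apply: genP.
have [eij|iSj] := eqVneq i.+1 j.
  subst j; rewrite pure_gen_conj_pred // conjgE.
  by apply: GenM; [apply/GenV|apply: GenM]; apply: genP => //; lia.
by rewrite pure_gen_conj_far //; apply: genP.
Qed.

Lemma pure_sub_conj i m x : i < m.-1 -> m <= r -> pure_sub m x ->
  generated (pure_sub m) (x ^ s i).
Proof.
move=> im mr [j jm ->].
have genP k : k < m -> generated (pure_sub m) (pure_gen k m).
  by move=> km; apply: GenIn; exists k.
have im' : i.+1 < m by lia.
have [eij|ij] := eqVneq i j.
  subst j; have -> : pure_gen i m ^ s i =
    pure_gen i.+1 m ^ (pure_gen i m)^-1.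
    apply: (@conjg_inj _ (s i)^-1); rewrite conjgK.
    rewrite (conjJg (pure_gen i.+1 m)) conjVg.
    rewrite pure_gen_conj_pred // pure_gen_conj_succ //.
    by rewrite conjgK.
  rewrite conjgE invgK.
  by apply: GenM; [|apply: GenM; [|apply: GenV]]; apply: genP => //; lia.
have [eij|iSj] := eqVneq i.+1 j.
  subst j; rewrite -pure_gen_conj_succ // conjgKV; apply: genP; lia.
rewrite -(pure_gen_conj_far _ _ iSj) ?conjgKV //; exact: genP.
Qed.

(* Right multiplication by [s i] permutes the cosets of the stabiliser        *)
(* [U_m B_m] of the last strand, represented by the descents to [j].          *)
Lemma braid_coset m x : m <= r -> generated (braid_sub m) x ->
  exists u h j, [/\ generated (pure_sub m) u, generated (braid_sub m.-1) h,
                   j <= m & x = u * h * descent m j].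
Proof.
move=> mr.
pose H := generated (fun z => pure_sub m z \/ braid_sub m.-1 z).
pose C j z := exists2 h, H h & z = h * descent m j.
suff CX z : generated (braid_sub m) z -> forall j, j <= m ->
    (exists2 k, k <= m & C k (descent m j * z)) /\
    (exists2 k, k <= m & C k (descent m j * z^-1)).
  move=> /CX /(_ m (leqnn m)) [+ _]; rewrite descent_nn mul1g => -[j jm [h Hh ->]].
  have [||u [b [Uu Bb ->]]] := generated_mul _ _ Hh; last by exists u, b, j.
  - by move=> z t Pz [i im ->]; apply: pure_sub_conj.
  - by move=> z t Pz [i im ->]; apply: pure_sub_conjV.
elim=> {x z} [x [i im ->]||x y _ IHx _ IHy|x _ IHx] j jm; last 1 first.
- by rewrite invgK and_comm; apply: IHx.
- have swm k : k <= m -> swapn i k <= m by rewrite /swapn; do !case: ifP; lia.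
  have key k : k <= m -> C (swapn i k) (descent m k * s i).
    move=> km; rewrite /swapn; have [->|ki] := eqVneq k i.
      exists (pure_gen i m); last by rewrite pure_genE // mulgVK.
      by apply: GenIn; left; exists i.
    have [eki|kSi] := eqVneq k i.+1.
      by exists 1; [apply: Gen1|rewrite eki mul1g -descentSr].
    have [ltki|leik] := ltnP k i.
      exists (s i.-1); first by apply: GenIn; right; exists i.-1 => //; lia.
      by rewrite descent_shift ?prednK //; lia.
    exists (s i); first by apply: GenIn; right; exists i => //; lia.
    by rewrite descent_far //; lia.
  split; exists (swapn i j); rewrite ?swm //; first exact: key.
  have [h Hh E] := key _ (swm _ jm); exists h^-1; first exact: GenV.
  by rewrite swapnK in E; apply: (@mulgI _ h); rewrite mulVKg mulgA -E mulgK.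
- rewrite invg1 mulg1; suff: exists2 k, k <= m & C k (descent m j) by [].
  by exists j => //; exists 1; rewrite ?mul1g //; apply: Gen1.
- rewrite invgM !mulgA; split.
  + have [[k km [h Hh ->]] _] := IHx _ jm; have [[l lm [g Hg E]] _] := IHy _ km.
    by exists l => //; exists (h * g); [apply: GenM|rewrite -!mulgA E].
  + have [_ [k km [h Hh ->]]] := IHy _ jm; have [_ [l lm [g Hg E]]] := IHx _ km.
    by exists l => //; exists (h * g); [apply: GenM|rewrite -!mulgA E].
Qed.

End Combing.

(** * The reduced Magnus ring *)

Section ReducedMagnus.
Local Open Scope ring_scope.
Variable n : nat.

Definition reduced (w : seq nat) : bool := uniq w && all (fun k => (k < n)%N) w.

Fixpoint nat_words (l : nat) : seq (seq nat) :=
  if l is l'.+1 then [seq k :: w | k <- iota 0 n, w <- nat_words l'] else [:: [::]].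

Definition basis : seq (seq nat) :=
  undup [seq w <- flatten [seq nat_words l | l <- iota 0 n.+1] | reduced w].

Lemma mem_nat_words w : all (fun k => (k < n)%N) w -> w \in nat_words (size w).
Proof.
elim: w => // k w IHw /= /andP[kn /IHw ww]; apply/allpairsP.
by exists (k, w); rewrite mem_iota.
Qed.

Lemma mem_basis w : (w \in basis) = reduced w.
Proof.
rewrite mem_undup mem_filter; apply: andb_idr => /andP[uw wn].
apply/flatten_mapP; exists (size w); last exact: mem_nat_words.
rewrite mem_iota add0n ltnS -(size_iota 0 n) uniq_leq_size // => k /(allP wn).
by rewrite mem_iota.
Qed.

Definition dim := size basis.

Local Notation mx := 'M[int]_dim.
Local Notation vec := 'cV[int]_dim.
Implicit Types (u v : vec) (w : seq nat) (A B : mx).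

Definition wcoef v w : int :=
  if insub (index w basis) is Some i then v i 0 else 0.

Definition bword (i : 'I_dim) : seq nat := nth [::] basis i.

Lemma reduced_bword i : reduced (bword i).
Proof. by rewrite -mem_basis mem_nth. Qed.

Lemma bword_inj : injective bword.
Proof.
by move=> i j /eqP; rewrite nth_uniq ?undup_uniq // => /eqP/val_inj.
Qed.

Lemma wcoef_bword v i : wcoef v (bword i) = v i 0.
Proof.
rewrite /wcoef index_uniq ?undup_uniq //.
by case: insubP => [j _ /val_inj->|/negP[]].
Qed.

Lemma reducedP w : reflect (exists i, w = bword i) (reduced w).
Proof.
apply: (iffP idP) => [|[i ->]]; last exact: reduced_bword.
rewrite -mem_basis => wb; have ltw : (index w basis < dim)%N by rewrite index_mem.
by exists (Ordinal ltw); rewrite /bword nth_index.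
Qed.

Lemma wcoef_junk v w : ~~ reduced w -> wcoef v w = 0.
Proof.
rewrite -mem_basis /wcoef => wb; rewrite insubF //.
by apply/negbTE; rewrite index_mem.
Qed.

Lemma wcoef_inj u v : (forall w, reduced w -> wcoef u w = wcoef v w) -> u = v.
Proof.
move=> uv; apply/matrixP=> i j; rewrite ord1 -!wcoef_bword.
exact/uv/reduced_bword.
Qed.

Lemma wcoefD u v w : wcoef (u + v) w = wcoef u w + wcoef v w.
Proof. by rewrite /wcoef; case: insub => [i|]; rewrite ?mxE ?addr0. Qed.
Lemma wcoefN u w : wcoef (- u) w = - wcoef u w.
Proof. by rewrite /wcoef; case: insub => [i|]; rewrite ?mxE ?oppr0. Qed.
Lemma wcoefB u v w : wcoef (u - v) w = wcoef u w - wcoef v w.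
Proof. by rewrite wcoefD wcoefN. Qed.
Lemma wcoef0 w : wcoef 0 w = 0.
Proof. by rewrite /wcoef; case: insub => [i|]; rewrite ?mxE. Qed.
Lemma wcoefZ c u w : wcoef (c *: u) w = c * wcoef u w.
Proof. by rewrite /wcoef; case: insub => [i|]; rewrite ?mxE ?mulr0. Qed.
Lemma wcoef_sum (I : Type) (r : seq I) (P : pred I) (F : I -> vec) w :
  wcoef (\sum_(i <- r | P i) F i) w = \sum_(i <- r | P i) wcoef (F i) w.
Proof. by apply: (big_morph (wcoef ^~ w)) => [u v|]; rewrite ?wcoefD ?wcoef0. Qed.

Lemma mulmxv_inj A B : (forall v, A *m v = B *m v) -> A = B.
Proof.
move=> AB; apply/matrixP => i j.
by have /matrixP/(_ i 0) := AB (delta_mx j 0); rewrite -!colE !mxE.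
Qed.

Definition pullback (K : seq nat -> seq (int * seq nat)) : mx :=
  \matrix_(i, j) \sum_(p <- K (bword i)) p.1 * (p.2 == bword j)%:R.

Lemma wcoef_pullback K v w : reduced w ->
  wcoef (pullback K *m v) w = \sum_(p <- K w) p.1 * wcoef v p.2.
Proof.
case/reducedP=> i ->; rewrite wcoef_bword mxE.
under eq_bigr => j _ do rewrite mxE mulr_suml.
rewrite exchange_big; apply: eq_bigr => -[c x] _ /=.
under eq_bigr => j _ do rewrite -mulrA.
rewrite -mulr_sumr; congr (_ * _).
have [/reducedP[j ->]|xb] := boolP (reduced x).
  rewrite wcoef_bword (bigD1 j) //= eqxx mul1r big1 ?addr0 // => k kj.
  by rewrite (inj_eq bword_inj) eq_sym (negbTE kj) mul0r.
rewrite wcoef_junk // big1 // => j _; case: eqP => [xj|]; last by rewrite mul0r.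
by rewrite xj reduced_bword in xb.
Qed.

Definition monomial w : vec := \col_i (bword i == w)%:R.

Lemma wcoef_monomial x w : reduced w -> wcoef (monomial x) w = (w == x)%:R.
Proof. by case/reducedP=> i ->; rewrite wcoef_bword mxE. Qed.

Lemma monomial_span v : v = \sum_(w <- basis) wcoef v w *: monomial w.
Proof.
apply: wcoef_inj => w wb; rewrite wcoef_sum (bigD1_seq w) ?mem_basis ?undup_uniq //=.
rewrite wcoefZ wcoef_monomial // eqxx mulr1 big1 ?addr0 // => x xw.
by rewrite wcoefZ wcoef_monomial // eq_sym (negbTE xw) mulr0.
Qed.

Definition has_letter k v := forall w, k \notin w -> wcoef v w = 0.

Lemma has_letterD k u v : has_letter k u -> has_letter k v -> has_letter k (u + v).
Proof. by move=> ku kv w kw; rewrite wcoefD ku // kv. Qed.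
Lemma has_letterN k u : has_letter k u -> has_letter k (- u).
Proof. by move=> ku w kw; rewrite wcoefN ku // oppr0. Qed.
Lemma has_letterB k u v : has_letter k u -> has_letter k v -> has_letter k (u - v).
Proof. by move=> ku kv; apply/has_letterD/has_letterN. Qed.
Lemma has_letter0 k : has_letter k 0.
Proof. by move=> w _; rewrite wcoef0. Qed.

Definition lmul j : mx :=
  pullback (fun w => if w is k :: x then if k == j then [:: (1, x)] else [::] else [::]).

Lemma wcoef_lmul_nil j v : wcoef (lmul j *m v) [::] = 0.
Proof. by rewrite wcoef_pullback // big_nil. Qed.

Lemma wcoef_lmul_cons j v k w : reduced (k :: w) ->
  wcoef (lmul j *m v) (k :: w) = if k == j then wcoef v w else 0.
Proof.
by move=> kw; rewrite wcoef_pullback //; case: ifP; rewrite ?big_nil ?big_seq1 ?mul1r.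
Qed.

Lemma reduced_cons k w : reduced (k :: w) = [&& (k < n)%N, k \notin w & reduced w].
Proof. by rewrite /reduced /=; case: (k \in w); case: (_ < _)%N; rewrite /= ?andbF. Qed.

Lemma monomial_cons k w : reduced (k :: w) -> monomial (k :: w) = lmul k *m monomial w.
Proof.
move=> kw; apply: wcoef_inj => -[|l x] lx; first by rewrite wcoef_lmul_nil wcoef_monomial.
rewrite wcoef_lmul_cons // wcoef_monomial // eqseq_cons; case: eqP => //= _.
by move: lx; rewrite reduced_cons => /and3P[_ _ /wcoef_monomial->].
Qed.

(* The ring is generated by its letters: [monomial [::]] is a cyclic vector. *)
Lemma lmul_cyclic A B : A *m monomial [::] = B *m monomial [::] ->
    (forall j, exists2 C, A *m lmul j = C *m A & B *m lmul j = C *m B) ->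
  A = B.
Proof.
move=> AB1 ABl; apply: mulmxv_inj => v; rewrite (monomial_span v) !mulmx_sumr.
apply: eq_big_seq => w; rewrite mem_basis -!scalemxAr => wb; congr (_ *: _).
elim: w wb => // k w IHw kw; rewrite monomial_cons //; have [C eA eB] := ABl k.
move: kw; rewrite reduced_cons => /and3P[_ _ /IHw ABw].
by rewrite !mulmxA eA eB -!mulmxA ABw.
Qed.

Lemma lmul_letter j v : has_letter j (lmul j *m v).
Proof.
move=> w jw; have [wb|/wcoef_junk//] := boolP (reduced w).
case: w jw wb => [|k w] jw wb; first by rewrite wcoef_lmul_nil.
by rewrite wcoef_lmul_cons //; case: eqP jw => // <-; rewrite in_cons eqxx.
Qed.

Lemma lmul_has_letter j k v : has_letter k v -> has_letter k (lmul j *m v).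
Proof.
move=> kv w; have [wb|/wcoef_junk//] := boolP (reduced w).
case: w wb => [|l w] wb; first by rewrite wcoef_lmul_nil.
rewrite wcoef_lmul_cons // in_cons negb_or => /andP[_ /kv->].
by rewrite if_same.
Qed.

Lemma lmul_kill j v : has_letter j v -> lmul j *m v = 0.
Proof.
move=> jv; apply: wcoef_inj => -[|k w] kw; first by rewrite wcoef_lmul_nil wcoef0.
rewrite wcoef_lmul_cons // wcoef0; case: eqP => // ekj; apply: jv.
by move: kw; rewrite reduced_cons -ekj => /and3P[].
Qed.

End ReducedMagnus.

(** * The action of the braid generators *)

Section BraidOperator.
Local Open Scope ring_scope.
Variable n : nat.
Local Notation mx := 'M[int]_(dim n).
Local Notation vec := 'cV[int]_(dim n).
Implicit Types (u v : vec) (w : seq nat).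
Local Notation lmul := (lmul n).

Fixpoint adj_sign (i : nat) w : int :=
  if w is k :: x then
    if (k == i) && (ohead x == Some i.+1) then 1
    else if (k == i.+1) && (ohead x == Some i) then -1
    else adj_sign i x
  else 0.

Lemma adj_signNl i w : i \notin w -> adj_sign i w = 0.
Proof.
elim: w => //= k w IHw; rewrite in_cons negb_or eq_sym => /andP[/negbTE-> iw] /=.
rewrite IHw // andbC; case: w iw {IHw} => //= l w.
by rewrite in_cons negb_or eq_sym => /andP[/negbTE ki _]; rewrite (inj_eq Some_inj) ki.
Qed.

Lemma adj_signNr i w : i.+1 \notin w -> adj_sign i w = 0.
Proof.
elim: w => //= k w IHw; rewrite in_cons negb_or eq_sym => /andP[/negbTE-> iw] /=.
rewrite IHw // andbC; case: w iw {IHw} => //= l w.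
by rewrite in_cons negb_or eq_sym => /andP[/negbTE ki _]; rewrite (inj_eq Some_inj) ki.
Qed.

(* The automorphism X_i |-> X_(i+1), X_(i+1) |-> X_i + [X_i, X_(i+1)], read   *)
(* on coefficients: the commutator contributes to the words in which i and    *)
(* i.+1 are adjacent.                                                         *)
Definition sigma_op (i : nat) : mx :=
  pullback n (fun w => [:: (1, map (swapn i) w); (adj_sign i w, rem i w)]).

Lemma wcoef_sigma_op i v w : reduced n w ->
  wcoef (sigma_op i *m v) w = wcoef v (map (swapn i) w) + adj_sign i w * wcoef v (rem i w).
Proof. by move=> nw; rewrite wcoef_pullback // big_cons big_seq1 mul1r. Qed.

Lemma reduced_rem k w : reduced n w -> reduced n (rem k w).
Proof.
case/andP=> uw wn; rewrite /reduced rem_uniq //=.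
by apply/allP => l /mem_rem/(allP wn).
Qed.

Lemma mem_rem_reduced k l w : reduced n w -> (l \in rem k w) = (l != k) && (l \in w).
Proof. by case/andP=> uw _; rewrite mem_rem_uniq // inE. Qed.

Lemma mem_map_swapn i k w : (k \in map (swapn i) w) = (swapn i k \in w).
Proof.
by rewrite -{1}[k](swapnK i) mem_map //; apply/inv_inj/swapnK.
Qed.

Lemma swapn_id i w : i \notin w -> i.+1 \notin w -> map (swapn i) w = w.
Proof.
move=> iw Siw; apply: map_id_in => k kw; rewrite /swapn.
by case: eqP kw iw => [->->|_] //; case: eqP Siw => [->|_] // /negbTE->.
Qed.

Variable i : nat.
Hypothesis ltin : (i.+1 < n)%N.

Lemma reduced_swap w : reduced n (map (swapn i) w) = reduced n w.
Proof.
rewrite /reduced map_inj_uniq; last exact/inv_inj/swapnK.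
congr (_ && _); rewrite all_map; apply: eq_all => k /=; rewrite /swapn.
by do !case: ifP; lia.
Qed.

Lemma sigma_op_vec1 : sigma_op i *m monomial n [::] = monomial n [::].
Proof.
apply: wcoef_inj => w nw; rewrite wcoef_sigma_op //.
rewrite !wcoef_monomial ?reduced_swap ?reduced_rem //.
have -> : (map (swapn i) w == [::]) = (w == [::]) by case: (w).
have [iw|iw] := boolP (i \in w); last by rewrite adj_signNl // mul0r addr0.
have [Siw|Siw] := boolP (i.+1 \in w); last by rewrite adj_signNr // mul0r addr0.
have : i.+1 \in rem i w by rewrite (mem_rem_reduced _ _ nw) Siw andbT gtn_eqF.
by case: (rem i w) => // k x _; rewrite mulr0 addr0.
Qed.

Lemma sigma_op_has_letter k v : has_letter k v -> has_letter (swapn i k) (sigma_op i *m v).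
Proof.
move=> kv w kw; have [wb|/wcoef_junk//] := boolP (reduced n w).
rewrite wcoef_sigma_op // kv ?mem_map_swapn // add0r.
have [ei|ki] := eqVneq k i; first by rewrite adj_signNr ?mul0r //; move: kw; rewrite /swapn ei eqxx.
have [eSi|kSi] := eqVneq k i.+1.
  by rewrite adj_signNl ?mul0r //; move: kw; rewrite /swapn eSi gtn_eqF // eqxx.
rewrite kv ?mulr0 //; apply: contra kw => /mem_rem.
by rewrite /swapn (negbTE ki) (negbTE kSi).
Qed.

Lemma sigma_op_lmul_eq : sigma_op i *m lmul i = lmul i.+1 *m sigma_op i.
Proof.
apply: mulmxv_inj => v; rewrite -!mulmxA; apply: wcoef_inj => w nw.
have lrem : wcoef (lmul i *m v) (rem i w) = 0.
  by apply: lmul_letter; rewrite (mem_rem_reduced _ _ nw) eqxx.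
rewrite wcoef_sigma_op // lrem mulr0 addr0.
case: w nw {lrem} => [|k w] nw; first by rewrite /= !wcoef_lmul_nil.
rewrite wcoef_lmul_cons //= wcoef_lmul_cons ?(reduced_swap (k :: w)) //.
have -> : (swapn i k == i) = (k == i.+1) by rewrite /swapn; do !case: ifP; lia.
case: eqP nw => // -> ; rewrite reduced_cons => /and3P[_ Siw nw].
by rewrite wcoef_sigma_op // (adj_signNr Siw) mul0r addr0.
Qed.

Lemma sigma_op_lmul_far j : j != i -> j != i.+1 -> sigma_op i *m lmul j = lmul j *m sigma_op i.
Proof.
move=> ji jSi; apply: mulmxv_inj => v; rewrite -!mulmxA; apply: wcoef_inj => w nw.
rewrite wcoef_sigma_op //; case: w nw => [|k w] nw; first by rewrite /= !wcoef_lmul_nil mul0r.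
rewrite wcoef_lmul_cons // /= wcoef_lmul_cons ?(reduced_swap (k :: w)) //.
have -> : (swapn i k == j) = (k == j) by rewrite /swapn; do !case: ifP; lia.
have [/= iw Siw nrw] : [/\ k \notin w, (k < n)%N & reduced n w].
  by move: nw; rewrite reduced_cons => /and3P[].
have nrem : reduced n (rem i w).
  exact: reduced_rem.
have [eki|ki] := eqVneq k i.
  subst k; rewrite eq_sym (negbTE ji) add0r /= (ltn_eqF (ltnSn i)) /=.
  have [/eqP|_] := eqVneq (ohead w) _; last by rewrite adj_signNl ?mul0r.
  case: w {iw nw nrem} nrw => //= l w nrw /eqP[el]; subst l.
  by rewrite mul1r wcoef_lmul_cons // ifN // eq_sym.
rewrite wcoef_lmul_cons; last first.
  by rewrite reduced_cons Siw nrem andbT /=; apply: contra iw => /mem_rem.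
have [ekSi|kSi] /= := eqVneq k i.+1.
  by rewrite ekSi (eq_sym i.+1) (negbTE jSi) mulr0 addr0.
by case: eqP => // _; rewrite ?mulr0 ?addr0 // wcoef_sigma_op.
Qed.

Lemma sigma_op_lmul_succ :
  sigma_op i *m lmul i.+1 =
  (lmul i + lmul i *m lmul i.+1 - lmul i.+1 *m lmul i) *m sigma_op i.
Proof.
apply: mulmxv_inj => v; rewrite -[in LHS]mulmxA -[in RHS]mulmxA.
rewrite mulmxBl mulmxDl -!(mulmxA (lmul _)).
set v' := sigma_op i *m v; apply: wcoef_inj => w nw.
rewrite wcoef_sigma_op // wcoefB wcoefD.
case: w nw => [|k w] nw; first by rewrite /= !wcoef_lmul_nil mul0r.
rewrite !(wcoef_lmul_cons _ _ nw) // [map _ _]/= wcoef_lmul_cons ?(reduced_swap (k :: w)) //.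
have [kw kn nrw] : [/\ k \notin w, (k < n)%N & reduced n w].
  by move: nw; rewrite reduced_cons => /and3P[].
have [eki|ki] := eqVneq k i.
  subst k; rewrite {1}/swapn eqxx eqxx [i == i.+1]ltn_eqF // subr0.
  rewrite {1}/v' wcoef_sigma_op // (adj_signNl kw) mul0r addr0; congr (_ + _).
  rewrite /= eqxx [i == i.+1]ltn_eqF //=; have [/eqP|Siw] := eqVneq (ohead w) _.
    case: w {nw} kw nrw => //= l w; rewrite in_cons negb_or => /andP[_ iw].
    move=> nrw /eqP[el]; subst l.
    rewrite mul1r !wcoef_lmul_cons // eqxx.
    move: nrw; rewrite reduced_cons => /and3P[_ Siw nrw].
    by rewrite /v' wcoef_sigma_op // adj_signNl // mul0r addr0 swapn_id.
  rewrite adj_signNl // mul0r; case: w Siw {nw kw} nrw => [|l w] Siw nrw.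
    by rewrite wcoef_lmul_nil.
  by rewrite wcoef_lmul_cons //; case: eqP => // el; rewrite el eqxx in Siw.
have [ekSi|kSi] := eqVneq k i.+1.
  subst k; rewrite /swapn (gtn_eqF (ltnSn i)) eqxx.
  rewrite ltn_eqF // !add0r /= eqxx (gtn_eqF (ltnSn i)) /=.
  have [/eqP|iw] := eqVneq (ohead w) (Some i).
    case: w {nw} kw nrw => //= l w; rewrite in_cons negb_or => /andP[_ Siw].
    move=> nrw /eqP[el]; subst l; rewrite eqxx.
    move: (nrw); rewrite reduced_cons => /and3P[_ iw nw].
    rewrite wcoef_lmul_cons ?reduced_cons ?kn ?Siw ?nw // eqxx mulN1r.
    rewrite wcoef_lmul_cons // eqxx /v' wcoef_sigma_op // adj_signNl // mul0r addr0.
    by rewrite swapn_id.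
  rewrite (adj_signNr kw) mul0r; case: w iw {nw kw} nrw => [|l w] iw nrw.
    by rewrite wcoef_lmul_nil oppr0.
  rewrite wcoef_lmul_cons //; case: eqP => [el|_]; last by rewrite oppr0.
  by rewrite el eqxx in iw.
have -> : (swapn i k == i.+1) = false by rewrite /swapn; do !case: ifP; lia.
rewrite /= (negbTE ki) wcoef_lmul_cons; last first.
  by rewrite reduced_cons kn reduced_rem // andbT; apply: contra kw => /mem_rem.
by rewrite (negbTE kSi) mulr0.
Qed.

Lemma sigma_op_sq_letter v : let d := sigma_op i *m (sigma_op i *m v) - v in
  has_letter i d /\ has_letter i.+1 d.
Proof.
split=> w kw; have [nw|/wcoef_junk//] := boolP (reduced n w).
- rewrite wcoefB wcoef_sigma_op // wcoef_sigma_op ?reduced_swap // (adj_signNl kw) adj_signNr.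
  + by rewrite !mul0r !addr0 (mapK (swapnK i)) subrr.
  + by rewrite mem_map_swapn /swapn (gtn_eqF (ltnSn i)) eqxx.
- rewrite wcoefB wcoef_sigma_op // wcoef_sigma_op ?reduced_swap // (adj_signNr kw) adj_signNl.
  + by rewrite !mul0r !addr0 (mapK (swapnK i)) subrr.
  + by rewrite mem_map_swapn /swapn eqxx.
Qed.

Lemma sigma_op_sq_id v : has_letter i v -> has_letter i.+1 v ->
  sigma_op i *m (sigma_op i *m v) = v.
Proof.
move=> iv Siv; apply: wcoef_inj => w nw.
rewrite wcoef_sigma_op // !wcoef_sigma_op ?reduced_swap ?reduced_rem // (mapK (swapnK i)).
rewrite (iv (rem i _)); last by rewrite mem_rem_reduced ?reduced_swap // eqxx.
rewrite (Siv (map _ (rem i w))); last first.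
  by rewrite mem_map_swapn /swapn (gtn_eqF (ltnSn i)) eqxx mem_rem_reduced // eqxx.
rewrite (adj_signNl (w := rem i w)); last by rewrite mem_rem_reduced // eqxx.
by rewrite mul0r !mulr0 !addr0.
Qed.

Definition sigma_opV : mx := sigma_op i + sigma_op i - sigma_op i *m (sigma_op i *m sigma_op i).

Lemma sigma_op_sigma_opV : sigma_op i *m sigma_opV = 1%:M.
Proof.
apply: mulmxv_inj => v; rewrite mul1mx mulmxBr mulmxDr mulmxBl mulmxDl -!mulmxA.
have [] := sigma_op_sq_letter v; set u := _ - v => iu Siu.
have E : sigma_op i *m (sigma_op i *m v) = v + u by rewrite addrC subrK.
move: u iu Siu E => u iu Siu E; rewrite E !mulmxDr E (sigma_op_sq_id iu Siu).
by apply/eqP; rewrite subr_eq addrACA !addrA.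
Qed.

Lemma sigma_opV_has_letter k v : has_letter k v -> has_letter (swapn i k) (sigma_opV *m v).
Proof.
move=> kv; rewrite mulmxBl mulmxDl -!mulmxA.
apply: has_letterB; first by apply: has_letterD; apply: sigma_op_has_letter.
by rewrite -[swapn i k](swapnK i); do 3!apply: sigma_op_has_letter.
Qed.

End BraidOperator.

Section BraidRelations.
Local Open Scope ring_scope.
Variable n : nat.
Local Notation mx := 'M[int]_(dim n).
Local Notation vec := 'cV[int]_(dim n).
Implicit Types (u v : vec) (A B : mx).
Local Notation L := (lmul n).
Local Notation S := (sigma_op n).

Lemma mulmx_pull (p q : nat) (X Y Z : 'M[int]_p) (W : 'M[int]_(p, q)) :
  X *m Y = Z *m X -> X *m (Y *m W) = Z *m (X *m W).
Proof. by move=> XY; rewrite mulmxA XY mulmxA. Qed.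

(* [twist X_i X_(i+1)] is the image of X_(i+1) under the i-th generator. *)
Definition twist (p : nat) (Y Z : 'M[int]_p) := Y + Y *m Z - Z *m Y.

Lemma mulmx_twist (p : nat) (X Y Z Y' Z' : 'M[int]_p) :
  X *m Y = Y' *m X -> X *m Z = Z' *m X -> X *m twist Y Z = twist Y' Z' *m X.
Proof.
move=> XY XZ; rewrite /twist mulmxBr mulmxDr mulmxBl mulmxDl -!mulmxA.
by rewrite XY (mulmx_pull _ XY) (mulmx_pull _ XZ) XZ XY.
Qed.

Lemma twist_distr (p : nat) (a b c : 'M[int]_p) :
    c *m c = 0 -> c *m (a *m c) = 0 -> c *m (b *m c) = 0 ->
    c *m (a *m (b *m c)) = 0 -> c *m (b *m (a *m c)) = 0 ->
  twist (twist a b) c = twist (twist a c) (twist b c).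
Proof.
move=> cc cac cbc cabc cbac; rewrite /twist !(mulmxDr, mulmxDl, mulmxN, mulNmx) -!mulmxA.
have ccx x : c *m (c *m x) = 0 by rewrite mulmxA cc mul0mx.
have cacx x : c *m (a *m (c *m x)) = 0 by rewrite !mulmxA -(mulmxA c a) cac mul0mx.
have cbcx x : c *m (b *m (c *m x)) = 0 by rewrite !mulmxA -(mulmxA c b) cbc mul0mx.
rewrite !(cc, cac, cbc, cabc, cbac, ccx, cacx, cbcx, mulmx0).
rewrite oppr0 !addr0 !opprB !opprD !opprK !addrA.
move: (a *m b) (b *m a) (a *m c) (c *m a) (a *m (b *m c)) => ab ba ac ca abc.
move: (b *m ac) (c *m ab) (c *m ba) (a *m (c *m b)) (b *m ca) => bac cab cba acb bca.
apply/matrixP => i j; rewrite !mxE; ring.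
Qed.

Lemma sigma_op_braid i : (i.+2 < n)%N ->
  S i *m (S i.+1 *m S i) = S i.+1 *m (S i *m S i.+1).
Proof.
move=> lt2; have lt1 : (i.+1 < n)%N by apply: ltnW.
have Sa := sigma_op_lmul_eq lt1; have Sb := sigma_op_lmul_succ lt1.
have Sc : S i *m L i.+2 = L i.+2 *m S i by apply: sigma_op_lmul_far => //; lia.
have Ta : S i.+1 *m L i = L i *m S i.+1 by apply: sigma_op_lmul_far => //; lia.
have Tb := sigma_op_lmul_eq lt2; have Tc := sigma_op_lmul_succ lt2.
have K0 : L i.+2 *m L i.+2 = 0.
  apply: mulmxv_inj => v; rewrite mul0mx -!mulmxA.
  by apply: lmul_kill; apply: lmul_letter.
have K1 x : L i.+2 *m (L x *m L i.+2) = 0.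
  apply: mulmxv_inj => v; rewrite mul0mx -!mulmxA.
  by apply: lmul_kill; apply: lmul_has_letter; apply: lmul_letter.
have K2 x y : L i.+2 *m (L x *m (L y *m L i.+2)) = 0.
  apply: mulmxv_inj => v; rewrite mul0mx -!mulmxA.
  by apply: lmul_kill; do 2!apply: lmul_has_letter; apply: lmul_letter.
have far j : j != i -> j != i.+1 -> j != i.+2 ->
    S i *m L j = L j *m S i /\ S i.+1 *m L j = L j *m S i.+1.
  by move=> ? ? ?; rewrite !sigma_op_lmul_far.
have := sigma_op_vec1 lt1; have := sigma_op_vec1 lt2.
move: (K1 i) (K1 i.+1) (K2 i i.+1) (K2 i.+1 i) => {K1 K2}.
move: (S i) (S i.+1) Sa Sb Sc Ta Tb Tc far => s t Sa Sb Sc Ta Tb Tc far.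
move=> K1 K1' K2 K2' t1 s1.
apply: lmul_cyclic => [|j]; first by rewrite -!mulmxA !(s1, t1).
have [->|ji] := eqVneq j i.
  exists (L i.+2).
    by rewrite -!mulmxA Sa (mulmx_pull _ Tb) (mulmx_pull _ Sc).
  by rewrite -!mulmxA Ta (mulmx_pull _ Sa) (mulmx_pull _ Tb).
have [->|jSi] := eqVneq j i.+1.
  exists (twist (L i.+1) (L i.+2)).
    rewrite -!mulmxA Sb (mulmx_pull _ (mulmx_twist Ta Tb)).
    by rewrite (mulmx_pull _ (mulmx_twist Sa Sc)).
  by rewrite -!mulmxA Tb (mulmx_pull _ Sc) (mulmx_pull _ Tc).
have [->|jSSi] := eqVneq j i.+2; last first.
  have [sj tj] := far j ji jSi jSSi; exists (L j).
    by rewrite -!mulmxA sj (mulmx_pull _ tj) (mulmx_pull _ sj).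
  by rewrite -!mulmxA tj (mulmx_pull _ sj) (mulmx_pull _ tj).
exists (twist (twist (L i) (L i.+1)) (L i.+2)).
  by rewrite -!mulmxA Sc (mulmx_pull _ Tc) (mulmx_pull _ (mulmx_twist Sb Sc)).
rewrite -!mulmxA Tc (mulmx_pull _ (mulmx_twist Sb Sc)).
by rewrite (mulmx_pull _ (mulmx_twist (mulmx_twist Ta Tb) Tc)) -twist_distr.
Qed.

Lemma sigma_op_far i j : (i.+1 < j)%N -> (j.+1 < n)%N -> S i *m S j = S j *m S i.
Proof.
move=> ij jn; have lti : (i.+1 < n)%N by lia.
have far k : k != i -> k != i.+1 -> S i *m L k = L k *m S i.
  by move=> ki kSi; apply: sigma_op_lmul_far.
have far' k : k != j -> k != j.+1 -> S j *m L k = L k *m S j.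
  by move=> kj kSj; apply: sigma_op_lmul_far.
apply: lmul_cyclic => [|k]; first by rewrite -!mulmxA !sigma_op_vec1.
have [->|ki] := eqVneq k i.
  have Ti : S j *m L i = L i *m S j by apply: far'; lia.
  have TSi : S j *m L i.+1 = L i.+1 *m S j by apply: far'; lia.
  exists (L i.+1); first by rewrite -!mulmxA Ti (mulmx_pull _ (sigma_op_lmul_eq lti)).
  by rewrite -!mulmxA (sigma_op_lmul_eq lti) (mulmx_pull _ TSi).
have [->|kSi] := eqVneq k i.+1.
  have Ti : S j *m L i = L i *m S j by apply: far'; lia.
  have TSi : S j *m L i.+1 = L i.+1 *m S j by apply: far'; lia.
  exists (twist (L i) (L i.+1)).
    by rewrite -!mulmxA TSi (mulmx_pull _ (sigma_op_lmul_succ lti)).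
  by rewrite -!mulmxA (sigma_op_lmul_succ lti) (mulmx_pull _ (mulmx_twist Ti TSi)).
have [->|kj] := eqVneq k j.
  have Tj : S i *m L j = L j *m S i by apply: far; lia.
  have TSj : S i *m L j.+1 = L j.+1 *m S i by apply: far; lia.
  exists (L j.+1); last by rewrite -!mulmxA Tj (mulmx_pull _ (sigma_op_lmul_eq jn)).
  by rewrite -!mulmxA (sigma_op_lmul_eq jn) (mulmx_pull _ TSj).
have [->|kSj] := eqVneq k j.+1.
  have Tj : S i *m L j = L j *m S i by apply: far; lia.
  have TSj : S i *m L j.+1 = L j.+1 *m S i by apply: far; lia.
  exists (twist (L j) (L j.+1)).
    by rewrite -!mulmxA (sigma_op_lmul_succ jn) (mulmx_pull _ (mulmx_twist Tj TSj)).
  by rewrite -!mulmxA TSj (mulmx_pull _ (sigma_op_lmul_succ jn)).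
exists (L k); first by rewrite -!mulmxA far' // (mulmx_pull _ (far _ ki kSi)).
by rewrite -!mulmxA far // (mulmx_pull _ (far' _ kj kSj)).
Qed.

End BraidRelations.

(** * The action of pure braids *)

Section PureAction.
Local Open Scope ring_scope.
Variable n : nat.
Local Notation mx := 'M[int]_(dim n).
Local Notation vec := 'cV[int]_(dim n).
Local Notation GL := (GLmatrix (dim n) int).
Implicit Types (u v : vec) (A B : mx).
Local Notation L := (lmul n).

Definition strip k : mx := pullback n (fun w => [:: (1, k :: w)]).

Lemma wcoef_strip k v w : reduced n w -> wcoef (strip k *m v) w = wcoef v (k :: w).
Proof. by move=> nw; rewrite wcoef_pullback // big_seq1 mul1r. Qed.

Definition permop i : mx := pullback n (fun w => [:: (1, map (swapn i) w)]).

Lemma wcoef_permop i v w : reduced n w -> wcoef (permop i *m v) w = wcoef v (map (swapn i) w).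
Proof. by move=> nw; rewrite wcoef_pullback // big_seq1 mul1r. Qed.

Lemma permop_lmul i j v : (i.+1 < n)%N -> j != i -> j != i.+1 ->
  permop i *m (L j *m v) = L j *m (permop i *m v).
Proof.
move=> lti ji jSi; apply: wcoef_inj => w nw; rewrite wcoef_permop //.
case: w nw => [|k w] nw; first by rewrite !wcoef_lmul_nil.
rewrite /= !wcoef_lmul_cons ?(reduced_swap lti (k :: w)) //.
have -> : (swapn i k == j) = (k == j) by rewrite /swapn; do !case: ifP; lia.
by case: eqP nw => // _; rewrite reduced_cons => /and3P[_ _ nw]; rewrite wcoef_permop.
Qed.

Lemma strip_sigma_op i v : (i.+1 < n)%N -> has_letter i v ->
  strip i.+1 *m (sigma_op n i *m v) = permop i *m (strip i *m v).
Proof.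
move=> lti iv; apply: wcoef_inj => w nw.
rewrite wcoef_strip // wcoef_permop // wcoef_strip ?reduced_swap //.
have [nSw|nSw] := boolP (reduced n (i.+1 :: w)); last first.
  rewrite !wcoef_junk //; apply: contra nSw => niw.
  rewrite -(reduced_swap lti) /=.
  by rewrite /swapn (gtn_eqF (ltnSn i)) eqxx.
rewrite wcoef_sigma_op // (iv (rem _ _)); last by rewrite (mem_rem_reduced _ _ nSw) eqxx.
by rewrite mulr0 addr0 /= {1}/swapn (gtn_eqF (ltnSn i)) eqxx.
Qed.

Lemma strip_sigma_op_sq j v : (j.+1 < n)%N -> has_letter j.+1 v ->
  strip j.+1 *m (sigma_op n j *m (sigma_op n j *m v)) =
  strip j.+1 *m v + L j *m (strip j.+1 *m v).
Proof.
move=> lti Sjv; apply: wcoef_inj => w nw; rewrite wcoefD !wcoef_strip //.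
have jB : has_letter j (sigma_op n j *m v).
  have := @sigma_op_has_letter _ j _ _ Sjv.
  by rewrite /swapn (gtn_eqF (ltnSn j)) eqxx.
have [nSw|nSw] := boolP (reduced n (j.+1 :: w)); last first.
  rewrite !(wcoef_junk _ nSw) add0r.
  case: w nw nSw => [|k x] nw nSw; first by rewrite wcoef_lmul_nil.
  rewrite wcoef_lmul_cons //; case: eqP => // ekj; subst k.
  move: (nw); rewrite reduced_cons => /and3P[_ _ nx]; rewrite wcoef_strip // wcoef_junk //.
  apply: contra nSw; rewrite !reduced_cons => /and3P[-> Sjx _].
  by move: nw; rewrite reduced_cons => ->; rewrite in_cons negb_or Sjx gtn_eqF.
move: (nSw); rewrite reduced_cons => /and3P[_ Sjw _].
rewrite wcoef_sigma_op // (jB (rem _ _)); last by rewrite (mem_rem_reduced _ _ nSw) eqxx.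
rewrite mulr0 addr0.
have nsw : reduced n (j :: map (swapn j) w).
  have <- : map (swapn j) (j.+1 :: w) = j :: map (swapn j) w.
    by rewrite /= {1}/swapn (gtn_eqF (ltnSn j)) eqxx.
  by rewrite reduced_swap.
rewrite [map _ _]/= {1}/swapn (gtn_eqF (ltnSn j)) eqxx wcoef_sigma_op //.
rewrite [map _ _]/= {1}/swapn eqxx (mapK (swapnK j)); congr (_ + _).
rewrite /= !eqxx /=.
case: w nw nSw Sjw nsw => [|k x] nw nSw Sjw nsw; first by rewrite wcoef_lmul_nil ltn_eqF // mul0r.
rewrite wcoef_lmul_cons // ltn_eqF // [ohead _]/=; have [ekj|kj] := eqVneq k j.
  subst k; rewrite /= {1 2}/swapn eqxx eqxx mul1r.
  move: (nw); rewrite reduced_cons => /and3P[_ jx nx].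
  rewrite wcoef_strip // swapn_id //; first by rewrite /swapn eqxx.
  by move: Sjw; rewrite in_cons negb_or => /andP[].
rewrite ifF.
  rewrite adj_signNl ?mul0r // (mem_map_swapn _ _ (k :: x)).
  by rewrite /swapn eqxx.
by apply: contraNF kj => /eqP[]; rewrite /swapn; do !case: ifP; lia.
Qed.

Section Action.
Variables (G : groupType) (f : UMagmaMorphism.type G GL) (s : nat -> G).
Hypothesis fs : forall i, (i.+1 < n)%N -> GLmx (f (s i)) = sigma_op n i.
Local Open Scope nat_scope.
Local Open Scope group_scope.

Definition act (x : G) : mx := f x.

Lemma actM x y : act (x * y) = act x *m act y.
Proof. by rewrite /act gmulfM. Qed.

Lemma act1 : act 1 = 1%:M%R.
Proof. by rewrite /act gmulf1. Qed.

Lemma actV x : act x *m act x^-1 = 1%:M%R.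
Proof. by rewrite -actM mulgV act1. Qed.

Lemma actVK x v : act x *m (act x^-1 *m v) = v.
Proof. by rewrite mulmxA actV mul1mx. Qed.

Lemma actK x v : act x^-1 *m (act x *m v) = v.
Proof. by rewrite -{2}[x]invgK actVK. Qed.

Lemma actJV x y v : act (x ^ y^-1) *m v = act y *m (act x *m (act y^-1 *m v)).
Proof. by rewrite conjgE invgK !actM -!mulmxA. Qed.

Lemma act_sigma i : i.+1 < n -> act (s i) = sigma_op n i.
Proof. exact: fs. Qed.

Lemma act_sigmaV i v : i.+1 < n -> act (s i)^-1 *m v = sigma_opV n i *m v.
Proof.
move=> lti; rewrite -[v in LHS]mul1mx -(sigma_op_sigma_opV lti) -!mulmxA -act_sigma //.
by rewrite actK.
Qed.

Definition keeps_letters x := forall k v, has_letter k v ->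
  has_letter k (act x *m v) /\ has_letter k (act x^-1 *m v).

Definition links j m x := forall v,
  [/\ has_letter j (act x *m v - v)%R, has_letter m (act x *m v - v)%R
    & has_letter j v -> has_letter m v -> act x *m v = v].

Lemma keeps_lettersM x y :
  keeps_letters x -> keeps_letters y -> keeps_letters (x * y).
Proof.
move=> xL yL k v kv; rewrite invgM !actM -!mulmxA; split.
- by have [/xL[]] := yL _ _ kv.
- by have [_ /yL[]] := xL _ _ kv.
Qed.

Lemma keeps_lettersV x : keeps_letters x -> keeps_letters x^-1.
Proof. by move=> xL k v /xL[xk xVk]; rewrite invgK. Qed.

Lemma keeps_letters1 : keeps_letters 1.
Proof. by move=> k v kv; rewrite invg1 act1 mul1mx. Qed.

Lemma generated_keeps_letters (S : G -> Prop) x :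
  (forall y, S y -> keeps_letters y) -> generated S x -> keeps_letters x.
Proof.
move=> SL; elim=> {x} [x /SL//||x y _ + _|x _].
- exact: keeps_letters1.
- exact: keeps_lettersM.
- exact: keeps_lettersV.
Qed.

Lemma linksJ j m x y : keeps_letters y -> links j m x -> links j m (x ^ y).
Proof.
move=> yL xjm v; rewrite conjgE !actM -!mulmxA.
have [jd md xid] := xjm (act y *m v).
have -> : (act y^-1 *m (act x *m (act y *m v)) - v)%R =
          act y^-1 *m (act x *m (act y *m v) - act y *m v)%R.
  by rewrite mulmxBr actK.
split; [by have [] := yL _ _ jd|by have [] := yL _ _ md|].
move=> /yL[jv _] /yL[mv _]; have [_ _ ->] := xjm (act y *m v) => //.
exact: actK.
Qed.

Lemma links_commute j m x y : links j m x -> links j m y ->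
  act (x * y) = act (y * x).
Proof.
move=> xjm yjm; rewrite !actM; apply: mulmxv_inj => v; rewrite -!mulmxA.
have [jd md _] := xjm v; have [je me _] := yjm v.
have [_ _ /(_ jd md) yd] := yjm (act x *m v - v)%R.
have [_ _ /(_ je me) xe] := xjm (act y *m v - v)%R.
move/eqP: xe; rewrite mulmxBr subr_eq => /eqP->.
by move/eqP: yd; rewrite mulmxBr subr_eq => /eqP->; rewrite addrAC [RHS]addrAC [X in (X - _)%R]addrC.
Qed.

Lemma pure_gen_succ j : pure_gen s j j.+1 = s j ^+ 2.
Proof. by rewrite /pure_gen descent_nn invg1 mulg1 mul1g. Qed.

Lemma pure_genS j m : j < m -> pure_gen s j m.+1 = pure_gen s j m ^ (s m)^-1.
Proof. by move=> jm; rewrite !pure_genJ descentSl // invgM conjgM. Qed.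

Lemma act_sigma_letter i k v : i.+1 < n -> has_letter k v ->
  has_letter (swapn i k) (act (s i) *m v) /\
  has_letter (swapn i k) (act (s i)^-1 *m v).
Proof.
move=> lti kv; rewrite act_sigma // act_sigmaV //.
by split; [apply: sigma_op_has_letter|apply: sigma_opV_has_letter].
Qed.

Lemma pure_gen_links j m : j < m -> m < n -> links j m (pure_gen s j m).
Proof.
elim: m => // m IHm; rewrite ltnS leq_eqVlt => /predU1P[<-|jm] mn v.
  rewrite pure_gen_succ expg2 actM act_sigma // -!mulmxA.
  by have [jd Sjd] := sigma_op_sq_letter mn v; split => // *; apply: sigma_op_sq_id.
rewrite pure_genS // actJV.
set v' := act (s m)^-1 *m v; have [jd md xid] := IHm jm (ltnW mn) v'.
have vE : act (s m) *m v' = v by apply: actVK.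
have -> : (act (s m) *m (act (pure_gen s j m) *m v') - v)%R =
          act (s m) *m (act (pure_gen s j m) *m v' - v')%R.
  by rewrite mulmxBr vE.
have sj : swapn m j = j by rewrite /swapn !ltn_eqF // ltnW.
have sm : swapn m m = m.+1 by rewrite /swapn eqxx.
have sSm : swapn m m.+1 = m by rewrite /swapn eqxx gtn_eqF.
split.
- by have [+ _] := act_sigma_letter mn jd; rewrite sj.
- by have [+ _] := act_sigma_letter mn md; rewrite sm.
- move=> /(act_sigma_letter mn)[_ +] /(act_sigma_letter mn)[_ +].
  by rewrite sj sSm => jv' mv'; rewrite xid.
Qed.

Lemma pure_gen_keeps_letters j m : j < m -> m < n ->
  keeps_letters (pure_gen s j m).
Proof.
elim: m => // m IHm; rewrite ltnS leq_eqVlt => /predU1P[<-|jm] mn k v kv.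
  rewrite pure_gen_succ expg2 invgM !actM -!mulmxA.
  rewrite -[k](swapnK j); split.
  + by have [/(act_sigma_letter mn)[]] := act_sigma_letter mn kv.
  + by have [_ /(act_sigma_letter mn)[]] := act_sigma_letter mn kv.
rewrite pure_genS // -conjVg !actJV -[k](swapnK m).
have [_ /(IHm jm (ltnW mn))[h1 h2]] := act_sigma_letter mn kv.
by split; [have [] := act_sigma_letter mn h1|have [] := act_sigma_letter mn h2].
Qed.

Lemma pure_gen_strip j m v : j < m -> m < n -> has_letter m v ->
  strip m *m (act (pure_gen s j m) *m v) =
  (strip m *m v + L j *m (strip m *m v))%R.
Proof.
elim: m v => // m IHm v; rewrite ltnS leq_eqVlt => /predU1P[<-|jm] mn mv.
  by rewrite pure_gen_succ expg2 actM act_sigma // -mulmxA strip_sigma_op_sq.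
rewrite pure_genS // actJV.
set v' := act (s m)^-1 *m v.
have vE : act (s m) *m v' = v by apply: actVK.
have mv' : has_letter m v'.
  have [_] := act_sigma_letter mn mv.
  by rewrite /swapn eqxx gtn_eqF.
have [mav _] := pure_gen_keeps_letters jm (ltnW mn) mv'.
rewrite act_sigma // strip_sigma_op // IHm ?(ltnW mn) // mulmxDr.
rewrite permop_lmul ?ltn_eqF ?(leqW jm) //.
by rewrite -strip_sigma_op // -act_sigma // vE.
Qed.

End Action.

End PureAction.

(** * Magnus's theorem for reduced free groups *)

Section BasicCommutators.
Local Open Scope nat_scope.
Local Open Scope group_scope.
Variables (G : groupType) (a : nat -> G) (m : nat).

Definition gens k (x : G) := exists2 j, j < k & x = a j.

Hypothesis aJ : forall i g, i < m -> generated (gens m) g -> commute (a i) (a i ^ g).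

Definition nclos i := generated (fun x => exists2 g, generated (gens m) g & x = a i ^ g).

Lemma nclos_commute i x y : i < m -> nclos i x -> nclos i y -> commute x y.
Proof.
move=> im; apply: generated_comm2 => {}x {}y [g Ug ->] [h Uh ->].
have /(aJ im) : generated (gens m) (h * g^-1) by apply/GenM/GenV.
by rewrite /commute => aa; have := conjMg (a i) (a i ^ (h * g^-1)) g;
   rewrite aa conjMg -!conjgM mulgVK => ->.
Qed.

Lemma nclosJ i x g : nclos i x -> generated (gens m) g -> nclos i (x ^ g).
Proof.
move=> Nx Ug; apply: generated_conj Nx => _ [h Uh ->].
by rewrite -conjgM; apply: GenIn; exists (h * g) => //; apply: GenM.
Qed.

Lemma nclos_gen i : nclos i (a i).
Proof. by apply: GenIn; exists 1; rewrite ?conjg1 //; apply: Gen1. Qed.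

Lemma gen_gens i : i < m -> generated (gens m) (a i).
Proof. by move=> im; apply: GenIn; exists i. Qed.

Lemma nclos_gens i x : i < m -> nclos i x -> generated (gens m) x.
Proof.
move=> im; apply: generated_sub => _ [g Ug ->]; rewrite conjgE.
by apply: GenM; [apply: GenV|apply: GenM => //; apply: gen_gens].
Qed.

Fixpoint bcom k (w : seq nat) : G :=
  if w is i :: x then [~ bcom k x, a i] else a k.

Lemma bcom_nclos k w l : k < m -> all (fun i => i < m) w -> l \in k :: w ->
  nclos l (bcom k w).
Proof.
move=> km; elim: w l => [l _|i w IHw l /= /andP[im wm]].
  by rewrite inE => /eqP->; apply: nclos_gen.
have Uw : generated (gens m) (bcom k w).
  by apply: nclos_gens km _; apply: IHw; rewrite ?mem_head.
rewrite !inE orbCA => /predU1P[->|lw]; last first.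
  have {}lw := IHw l wm lw; rewrite commgEl; apply: GenM; first exact: GenV.
  by apply: nclosJ => //; apply: gen_gens.
rewrite commgEr; apply: GenM; last exact: nclos_gen.
by apply: nclosJ => //; apply/GenV/nclos_gen.
Qed.

Lemma bcom_repeat k w : k < m -> all (fun i => i < m) w -> ~~ uniq w -> bcom k w = 1.
Proof.
move=> km; elim: w => //= i w IHw /andP[im wm]; rewrite negb_and negbK.
case/orP=> [iw|/(IHw wm)->]; last exact: comm1g.
apply/eqP/commgP/(nclos_commute im); last exact: nclos_gen.
by apply: bcom_nclos; rewrite ?in_cons ?iw ?orbT.
Qed.

Lemma bcom_commute k v w : k < m -> all (fun i => i < m) v ->
  all (fun i => i < m) w -> commute (bcom k v) (bcom k w).
Proof.
by move=> km vm wm; apply: (nclos_commute km); apply: bcom_nclos; rewrite ?mem_head.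
Qed.

Definition bcoms k (x : G) := exists2 w, all (fun i => i < k) w & x = bcom k w.

Lemma gens_split k x : k < m -> generated (gens k.+1) x ->
  exists y z, [/\ generated (bcoms k) y, generated (gens k) z & x = y * z].
Proof.
move=> km Ux; have allm w : all (fun i => i < k) w -> all (fun i => i < m) w.
  by apply: sub_all => i ik; apply: ltn_trans km.
have conjE i w : bcom k w ^ a i = bcom k w * bcom k (i :: w).
  by rewrite /= commgEl mulVKg.
apply: generated_mul => [_ _ [w wk ->] [i ik ->]|_ _ [w wk ->] [i ik ->]|].
- rewrite conjE; apply: GenM; apply: GenIn; [by exists w|].
  by exists (i :: w); rewrite //= ik.
- have -> : bcom k w ^ (a i)^-1 = bcom k w / bcom k (i :: w).
    apply: (@conjg_inj _ (a i)); rewrite conjgKV conjMg conjVg !conjE.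
    rewrite (@bcom_repeat _ [:: i, i & w]) ?mulg1 ?mulgK //=.
      by rewrite (ltn_trans ik km) allm.
    by rewrite mem_head.
  apply: GenM; [|apply: GenV]; apply: GenIn; [by exists w|].
  by exists (i :: w); rewrite //= ik.
apply: generatedW Ux => _ [j + ->]; rewrite ltnS leq_eqVlt => /predU1P[->|jk].
  by left; exists [::].
by right; exists j.
Qed.

Definition bcom_prod k (r : seq (seq nat)) (p : seq nat -> nat) : G :=
  \prod_(w <- r) bcom k w ^+ p w.

Lemma bcom_prodD k r p q : k < m -> {in r, forall w, all (fun i => i < m) w} ->
  bcom_prod k r p * bcom_prod k r q = bcom_prod k r (fun w => p w + q w)%N.
Proof.
move=> km; rewrite /bcom_prod.
elim: r => [|w r IHr] rm; first by rewrite !big_nil mulg1.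
have rm' : {in r, forall w, all (fun i => i < m) w}.
  by move=> v vr; apply: rm; rewrite in_cons vr orbT.
rewrite !big_cons -IHr // expgnDr -!mulgA; congr (_ * _); rewrite !mulgA; congr (_ * _).
apply/commute_sym; rewrite big_seq; apply: commute_prod => v vr.
by apply: commuteX2; apply: bcom_commute => //; apply: rm; rewrite ?mem_head ?in_cons ?vr ?orbT.
Qed.

Lemma bcoms_prod k r x : k < m -> {in r, forall w, all (fun i => i < m) w} ->
    uniq r -> (forall w, all (fun i => i < k) w -> uniq w -> w \in r) ->
    generated (bcoms k) x ->
  exists p q, x * bcom_prod k r p = bcom_prod k r q.
Proof.
move=> km rm ur rP; have D p q := bcom_prodD p q km rm.
have C p q : commute (bcom_prod k r p) (bcom_prod k r q).
  by rewrite /commute !D; apply: eq_bigr => w _; rewrite addnC.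
elim=> {x} [_ [w wk ->]||x y _ [p [q xpq]] _ [p' [q' ypq]]|x _ [p [q xpq]]].
- have [uw|nuw] := boolP (uniq w); last first.
    exists (fun=> 0%N), (fun=> 0%N); rewrite bcom_repeat ?mul1g //.
    by apply: sub_all wk => i ik; apply: ltn_trans km.
  exists (fun=> 0%N), (fun v => (v == w) : nat).
  rewrite /bcom_prod big1 // mulg1; under eq_bigr => v _ do rewrite expgb.
  by rewrite -big_mkcond -big_filter filter_pred1_uniq ?rP // big_seq1.
- by exists (fun=> 0%N), (fun=> 0%N); rewrite mul1g.
- exists (fun w => p w + p' w)%N, (fun w => q w + q' w)%N.
  by rewrite -!D (C p) -mulgA (mulgA y) ypq mulgA -(mulgA x) (C q') mulgA xpq.
- by exists q, p; rewrite -xpq mulKg.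
Qed.

End BasicCommutators.

Section ReducedMagnusTheorem.
Local Open Scope ring_scope.
Variable n : nat.
Local Notation mx := 'M[int]_(dim n).
Local Notation vec := 'cV[int]_(dim n).
Implicit Types (u v : vec) (A B C : mx).
Local Notation L := (lmul n).

Definition lacks_letter k v := forall w, k \in w -> wcoef v w = 0.

Definition preserves_lack k A := forall v, lacks_letter k v -> lacks_letter k (A *m v).

Lemma preserves_lackD k A B :
  preserves_lack k A -> preserves_lack k B -> preserves_lack k (A + B).
Proof. by move=> kA kB v kv w kw; rewrite mulmxDl wcoefD kA // kB. Qed.

Lemma preserves_lackN k A : preserves_lack k A -> preserves_lack k (- A).
Proof. by move=> kA v kv w kw; rewrite mulNmx wcoefN kA // oppr0. Qed.

Lemma preserves_lackM k A B :
  preserves_lack k A -> preserves_lack k B -> preserves_lack k (A *m B).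
Proof. by move=> kA kB v kv; rewrite -mulmxA; apply/kA/kB. Qed.

Lemma preserves_lack1 k : preserves_lack k 1%:M.
Proof. by move=> v kv; rewrite mul1mx. Qed.

Lemma preserves_lack_lmul k j : j != k -> preserves_lack k (L j).
Proof.
move=> jk v kv w; have [wb|/wcoef_junk//] := boolP (reduced n w).
case: w wb => [|l w] wb; first by rewrite wcoef_lmul_nil.
rewrite wcoef_lmul_cons // in_cons; have [->|] := eqVneq l j; last by [].
by rewrite eq_sym (negbTE jk) => /kv.
Qed.

(* Operators of degree one in X_k. *)
Definition letter_op k A :=
  (forall v, has_letter k (A *m v)) /\ (forall v, has_letter k v -> A *m v = 0).

Lemma letter_op_mul k A B : letter_op k A -> letter_op k B -> A *m B = 0.
Proof.
move=> [_ A0] [B1 _]; apply: mulmxv_inj => v.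
by rewrite -mulmxA mul0mx A0.
Qed.

Lemma letter_opD k A B : letter_op k A -> letter_op k B -> letter_op k (A + B).
Proof.
move=> [A1 A0] [B1 B0]; split=> v; first by rewrite mulmxDl; apply: has_letterD.
by move=> kv; rewrite mulmxDl A0 // B0 // addr0.
Qed.

Lemma letter_opN k A : letter_op k A -> letter_op k (- A).
Proof.
move=> [A1 A0]; split=> v; first by rewrite mulNmx; apply: has_letterN.
by move=> kv; rewrite mulNmx A0 // oppr0.
Qed.

Lemma letter_op0 k : letter_op k 0.
Proof. by split=> v *; rewrite mul0mx //; apply: has_letter0. Qed.

Lemma letter_op_lmul k : letter_op k (L k).
Proof. by split=> v; [apply: lmul_letter|apply: lmul_kill]. Qed.

Lemma letter_op_lmulr k j A : letter_op k A -> letter_op k (A *m L j).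
Proof.
move=> [A1 A0]; split=> v; rewrite -mulmxA // => kv.
by apply/A0/lmul_has_letter.
Qed.

Lemma letter_op_lmull k j A : letter_op k A -> letter_op k (L j *m A).
Proof.
move=> [A1 A0]; split=> v; rewrite -mulmxA; first exact: lmul_has_letter.
by move=> kv; rewrite A0 // mulmx0.
Qed.

Fixpoint bcom_op k (w : seq nat) : mx :=
  if w is i :: x then bcom_op k x *m L i - L i *m bcom_op k x else L k.

Lemma bcom_op_letter k w : letter_op k (bcom_op k w).
Proof.
elim: w => /= [|i w IHw]; first exact: letter_op_lmul.
by apply/letter_opD/letter_opN; [apply: letter_op_lmulr|apply: letter_op_lmull].
Qed.

Lemma bcom_op_lack k l w : k != l -> l \notin w -> preserves_lack l (bcom_op k w).
Proof.
move=> kl; elim: w => /= [_|i w IHw]; first exact: preserves_lack_lmul.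
rewrite in_cons negb_or eq_sym => /andP[il /IHw lw].
by apply/preserves_lackD/preserves_lackN; apply: preserves_lackM => //;
   apply: preserves_lack_lmul.
Qed.

Lemma bcom_op_has_letter k w l v : has_letter l v -> has_letter l (bcom_op k w *m v).
Proof.
elim: w v => /= [|i w IHw] v lv; first exact: lmul_has_letter.
rewrite mulmxBl -!mulmxA; apply: has_letterB; first exact/IHw/lmul_has_letter.
exact/lmul_has_letter/IHw.
Qed.

Lemma lmul_bcom_op_lmul i k w : L i *m bcom_op k w *m L i = 0.
Proof.
apply: mulmxv_inj => v; rewrite mul0mx -!mulmxA.
by apply/lmul_kill/bcom_op_has_letter/lmul_letter.
Qed.

Lemma wcoef_bcom_op k w x y : k \notin w ->
    reduced n (k :: y) -> reduced n (catrev w x) ->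
  wcoef (bcom_op k w *m monomial n x) (k :: y) = (y == catrev w x)%:R.
Proof.
move=> + ky; have ny : reduced n y by move: ky; rewrite reduced_cons => /and3P[].
elim: w x => /= [|i w IHw] x; first by rewrite wcoef_lmul_cons // eqxx wcoef_monomial.
rewrite in_cons negb_or => /andP[ki kw] wx.
rewrite mulmxBl -!mulmxA wcoefB wcoef_lmul_cons // (negbTE ki) subr0 -monomial_cons ?IHw //.
move: wx; rewrite /reduced catrevE cat_uniq all_cat.
by case/andP=> [/and3P[_ _ ->]] /andP[].
Qed.

Definition bcom_sum k (r : seq (seq nat)) (p : seq nat -> nat) : mx :=
  \sum_(w <- r) bcom_op k w *+ p w.

Lemma letter_opMn k A c : letter_op k A -> letter_op k (A *+ c).
Proof.
move=> kA; elim: c => [|c IHc]; first exact: letter_op0.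
by rewrite mulrS; apply: letter_opD.
Qed.

Lemma bcom_sum_letter k r p : letter_op k (bcom_sum k r p).
Proof.
rewrite /bcom_sum; elim/big_ind: _ => [|A B|w _]; first exact: letter_op0.
- exact: letter_opD.
- exact/letter_opMn/bcom_op_letter.
Qed.

Lemma bcom_sum_lack k l (r : seq (seq nat)) p : k != l -> {in r, forall w, l \notin w} ->
  preserves_lack l (bcom_sum k r p).
Proof.
move=> kl lr; rewrite /bcom_sum big_seq.
have lack0 : preserves_lack l (0 : mx) by move=> v _ w _; rewrite mul0mx wcoef0.
elim/big_ind: _ => [//|A B|w /lr lw]; first exact: preserves_lackD.
elim: (p w) => [//|c IHc]; rewrite mulrS; apply: preserves_lackD => //.
exact: bcom_op_lack.
Qed.

Lemma wcoef_bcom_sum k (r : seq (seq nat)) p w : uniq r -> {in r, forall x, reduced n (k :: x)} ->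
    w \in r ->
  wcoef (bcom_sum k r p *m monomial n [::]) (k :: rev w) = (p w)%:R.
Proof.
move=> ur rk wr; have kw := rk w wr.
have redrev x : reduced n (k :: x) -> reduced n (k :: rev x).
  by rewrite /reduced /= mem_rev rev_uniq all_rev.
have cfr x y c : reduced n (k :: x) -> reduced n (k :: y) ->
    wcoef (bcom_op k x *+ c *m monomial n [::]) (k :: rev y) = (y == x)%:R *+ c.
  move=> kx ky; rewrite -[in RHS](inj_eq (can_inj revK)).
  rewrite -(@wcoef_bcom_op k x [::]) ?redrev //; last 2 first.
  - by move: kx; rewrite reduced_cons => /and3P[].
  - by move: (redrev _ kx); rewrite reduced_cons => /and3P[].
  elim: c => [|c IHc]; first by rewrite mul0mx wcoef0.
  by rewrite !mulrS mulmxDl wcoefD IHc.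
rewrite mulmx_suml wcoef_sum (bigD1_seq w) //= big_seq_cond big1 ?addr0.
  by rewrite cfr // eqxx.
move=> x /andP[/rk kx xw].
by rewrite cfr // eq_sym (negbTE xw) mul0rn.
Qed.

Section MagnusRelation.
Variables (G : groupType) (a : nat -> G) (m : nat).
Variable mag : G -> mx -> Prop.
Local Open Scope nat_scope.
Local Open Scope group_scope.
Hypothesis mn : m <= n.
Hypothesis aJ : forall i g,
  i < m -> generated (gens a m) g -> commute (a i) (a i ^ g).
Hypothesis mag1 : mag 1 1%:M%R.
Hypothesis magM : forall x y A B, mag x A -> mag y B -> mag (x * y) (A *m B).
Hypothesis magV : forall x A B,
  mag x A -> A *m B = 1%:M%R -> B *m A = 1%:M%R -> mag x^-1 B.
Hypothesis mag_gen : forall i, i < m -> mag (a i) (1%:M + L i)%R.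

Lemma mulmx_1D1B C : C *m C = 0%R -> (1%:M + C)%R *m (1%:M - C)%R = 1%:M%R.
Proof.
by move=> CC; rewrite mulmxBr mulmx1 mulmxDl mul1mx CC addr0 addrK.
Qed.

Lemma mulmx_1B1D C : C *m C = 0%R -> (1%:M - C)%R *m (1%:M + C)%R = 1%:M%R.
Proof.
move=> CC; rewrite -{2}[C]opprK mulmx_1D1B //.
by rewrite mulNmx mulmxN CC !oppr0.
Qed.

Lemma mag1DV x C : C *m C = 0%R -> mag x (1%:M + C)%R -> mag x^-1 (1%:M - C)%R.
Proof. by move=> CC /magV; apply; rewrite ?mulmx_1D1B ?mulmx_1B1D. Qed.

Lemma mag1DM k x y C D : letter_op k C -> letter_op k D ->
  mag x (1%:M + C)%R -> mag y (1%:M + D)%R -> mag (x * y) (1%:M + (C + D))%R.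
Proof.
move=> Ck Dk /magM xC /xC; rewrite mulmxDl mul1mx mulmxDr mulmx1.
by rewrite (letter_op_mul Ck Dk) addr0 addrAC addrA.
Qed.

Lemma mag_bcom k w : k < m -> all (fun i => i < m) w ->
  mag (bcom a k w) (1%:M + bcom_op k w)%R.
Proof.
move=> km; elim: w => [_|i w IHw /= /andP[im /IHw mw]]; first exact: mag_gen.
have Ck := bcom_op_letter k w; set C := bcom_op k w in mw Ck *.
have CC := letter_op_mul Ck Ck.
have LL := letter_op_mul (letter_op_lmul i) (letter_op_lmul i).
have CLC : C *m L i *m C = 0%R := letter_op_mul (letter_op_lmulr i Ck) Ck.
have LCL : L i *m C *m L i = 0%R by apply: lmul_bcom_op_lmul.
have := magM (mag1DV CC mw) (magM (mag1DV LL (mag_gen im)) (magM mw (mag_gen im))).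
rewrite /commg /conjg; congr (mag _ _).
rewrite !(mulmxDr, mulmxDl, mulmxN, mulNmx, mulmx1, mul1mx, mulmxA).
have CLL : C *m L i *m L i = 0%R by rewrite -mulmxA LL mulmx0.
rewrite !(CC, LL, CLC, LCL, CLL, mul0mx, mulmx0, oppr0, addr0, opprK).
move: (C *m L i) (L i *m C) => CL LC.
by apply/matrixP => x y; rewrite !mxE; ring.
Qed.

Lemma mag_bcom_prod k (r : seq (seq nat)) p : k < m -> {in r, forall w, all (fun i => i < m) w} ->
  mag (bcom_prod a k r p) (1%:M + bcom_sum k r p)%R.
Proof.
move=> km; rewrite /bcom_prod /bcom_sum; elim: r => [|w r IHr] rm.
  by rewrite !big_nil addr0.
rewrite !big_cons; apply: (mag1DM (k := k)).
- exact/letter_opMn/bcom_op_letter.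
- exact: bcom_sum_letter.
- elim: (p w) => [|c IHc]; first by rewrite expg0 mulr0n addr0.
  rewrite expgS mulrS; apply: (mag1DM (k := k)) => //.
  + exact: bcom_op_letter.
  + exact/letter_opMn/bcom_op_letter.
  + by apply: mag_bcom => //; apply: rm; rewrite mem_head.
- by apply: IHr => v vr; apply: rm; rewrite in_cons vr orbT.
Qed.

Theorem magnus_faithful k x : k <= m -> generated (gens a k) x ->
  exists T, [/\ mag x T, forall l, k <= l -> preserves_lack l T
    & T *m monomial n [::] = monomial n [::] -> x = 1].
Proof.
elim: k x => [|k IHk] x km Ux.
  exists 1%:M%R; have -> : x = 1.
    by elim: Ux => {x} [x []//||x y _ -> _ ->|x _ ->]; rewrite ?mulg1 ?invg1.
  by split => // l _; apply: preserves_lack1.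
have [y [z [Ny Uz ->]]] := gens_split aJ km Ux.
have [T [zT lackT T1]] := IHk z (ltnW km) Uz.
pose r := [seq w <- basis n | all (fun i => i < k) w].
have rk w : w \in r -> all (fun i => i < k) w by rewrite mem_filter => /andP[].
have rm : {in r, forall w, all (fun i => i < m) w}.
  by move=> w /rk; apply: sub_all => i ik; apply: ltn_trans km.
have ur : uniq r by rewrite filter_uniq ?undup_uniq.
have rN w l : w \in r -> k <= l -> l \notin w.
  by move=> /rk/allP wk kl; apply/negP => /wk; rewrite ltnNge kl.
have rP w : all (fun i => i < k) w -> uniq w -> w \in r.
  move=> wk uw; rewrite mem_filter wk mem_basis /reduced uw.
  by apply: sub_all wk => i ik; apply: ltn_trans (leq_trans km mn).
have rR : {in r, forall w, reduced n (k :: w)}.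
  move=> w wr; rewrite reduced_cons (leq_trans km mn) rN //.
  by move: wr; rewrite mem_filter mem_basis => /andP[].
have [p [q ypq]] := bcoms_prod aJ km rm ur rP Ny.
have /(canRL (mulgK _)) yE := ypq.
pose D := (bcom_sum k r q - bcom_sum k r p)%R.
have Dk : letter_op k D.
  by apply/letter_opD/letter_opN; apply: bcom_sum_letter.
have yD : mag y (1%:M + D)%R.
  rewrite yE; have qk := bcom_sum_letter k r q; have pk := bcom_sum_letter k r p.
  apply: (mag1DM qk (letter_opN pk)); first exact: mag_bcom_prod.
  apply: mag1DV; first exact: (letter_op_mul pk pk).
  exact: mag_bcom_prod.
exists ((1%:M + D)%R *m T); split.
- exact: magM.
- move=> l kl; apply: preserves_lackM; last by apply/lackT/ltnW.
  apply: preserves_lackD; first exact: preserves_lack1.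
  by apply/preserves_lackD/preserves_lackN; apply: bcom_sum_lack;
     rewrite ?ltn_eqF // => w wr; apply: rN => //; apply: ltnW.
rewrite -mulmxA mulmxDl mul1mx => TD.
have Te : T *m monomial n [::] = monomial n [::].
  apply: wcoef_inj => w nw; have [kw|kw] := boolP (k \in w); last first.
    by rewrite -[in RHS]TD wcoefD (proj1 Dk) // addr0.
  have lack1 : lacks_letter k (monomial n [::]).
    move=> v kv; have [nv|/wcoef_junk//] := boolP (reduced n v).
    by rewrite wcoef_monomial //; case: eqP => // ev; rewrite ev in kv.
  by rewrite (lackT k) // lack1.
rewrite (T1 Te) mulg1 yE; apply/divg1_eq.
have De : D *m monomial n [::] = 0%R.
  by move: TD; rewrite Te => /eqP; rewrite -subr_eq0 addrAC subrr add0r => /eqP.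
suff -> : bcom_prod a k r p = bcom_prod a k r q by rewrite divgg invg1 mulg1.
rewrite /bcom_prod big_seq [RHS]big_seq; apply: eq_bigr => w wr; congr (_ ^+ _).
have := congr1 (fun u => wcoef u (k :: rev w)) De.
rewrite mulmxBl wcoefB wcoef0 !wcoef_bcom_sum // => /eqP; rewrite subr_eq0 eqr_nat => /eqP.
exact: esym.
Qed.

End MagnusRelation.
End ReducedMagnusTheorem.

(** * Linearity of the homotopy braid groups *)

Section Faithful.
Variables (n : nat) (G : groupType).
Variables (f : UMagmaMorphism.type G (GLmatrix (dim n) int)) (s : nat -> G).
Hypothesis fs : forall i, i.+1 < n -> GLmx (f (s i)) = sigma_op n i.
Hypothesis braid_adj : forall i, i.+1 < n.-1 ->
  s i * s i.+1 * s i = s i.+1 * s i * s i.+1.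
Hypothesis braid_far : forall i j, i.+1 < j -> j < n.-1 -> commute (s i) (s j).
Hypothesis pureJ : forall m i g, m < n -> i < m ->
  generated (pure_sub s m) g -> commute (pure_gen s i m) (pure_gen s i m ^ g).

Local Notation act := (act f).
Local Notation X k := (monomial n [:: k]).

Definition strip_action m x (A : 'M[int]_(dim n)) :=
  (forall v, has_letter m v ->
     has_letter m (act x *m v) /\ has_letter m (act x^-1 *m v)) /\
  (forall v, has_letter m v -> strip n m *m (act x *m v) = A *m (strip n m *m v)).

Lemma reduced1 k : k < n -> reduced n [:: k].
Proof. by move=> kn; rewrite /reduced /= kn. Qed.

Lemma has_letter_X k : has_letter k (X k).
Proof.
move=> w kw; have [nw|/wcoef_junk//] := boolP (reduced n w).
by rewrite wcoef_monomial //; have [ew|//] := eqVneq w [:: k]; rewrite ew mem_head in kw.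
Qed.

Lemma X_lmul k : k < n -> X k = lmul n k *m monomial n [::].
Proof. by move=> kn; rewrite monomial_cons ?reduced1. Qed.

Lemma strip_X k : k < n -> strip n k *m X k = monomial n [::].
Proof.
move=> kn; apply: wcoef_inj => w nw; rewrite wcoef_strip // (wcoef_monomial [::] nw).
have [nkw|nkw] := boolP (reduced n (k :: w)).
  by rewrite wcoef_monomial // eqseq_cons eqxx.
rewrite wcoef_junk //; have [ew|//] := eqVneq w [::].
by rewrite ew reduced1 in nkw.
Qed.

Lemma act_descent m j : j <= m -> m < n -> act (descent s m j) *m X j = X m.
Proof.
elim: m => [|m IHm]; first by rewrite leqn0 => /eqP-> _; rewrite descent_nn act1 mul1mx.
rewrite leq_eqVlt => /predU1P[->|jm] mn; first by rewrite descent_nn act1 mul1mx.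
rewrite descentSl // actM -mulmxA IHm ?(ltnW mn) // act_sigma //.
by rewrite !X_lmul ?(ltnW mn) // mulmxA sigma_op_lmul_eq // -mulmxA sigma_op_vec1.
Qed.

Lemma act_low m x : m < n -> generated (braid_sub s m.-1) x -> act x *m X m = X m.
Proof.
move=> mn; elim=> {x} [_ [i im ->]||x y _ xm _ ym|x _ xm].
- rewrite act_sigma //; last by lia.
  by rewrite X_lmul // mulmxA sigma_op_lmul_far -?mulmxA ?sigma_op_vec1 //; lia.
- by rewrite act1 mul1mx.
- by rewrite actM -mulmxA ym xm.
- by rewrite -{1}xm actK.
Qed.

Lemma strip_action_gen m j : j < m -> m < n ->
  strip_action m (pure_gen s j m) (1%:M + lmul n j)%R.
Proof.
move=> jm mn; split=> v mv; first exact: pure_gen_keeps_letters.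
by rewrite (pure_gen_strip fs) // mulmxDl mul1mx.
Qed.

Lemma strip_actionM m x y A B :
  strip_action m x A -> strip_action m y B -> strip_action m (x * y) (A *m B).
Proof.
move=> [xm xA] [ym yB]; split=> v mv; rewrite ?invgM !actM -!mulmxA.
  by have [/xm[? _] _] := ym v mv; have [_ /ym[_ ?]] := xm v mv.
by rewrite xA ?yB //; have [] := ym v mv.
Qed.

Lemma strip_actionV m x A B : strip_action m x A -> B *m A = 1%:M%R ->
  strip_action m x^-1 B.
Proof.
move=> [xm xA] BA; split=> v mv; first by rewrite invgK and_comm; apply: xm.
have [_ xvm] := xm v mv.
by rewrite -[v in RHS](actVK f x) xA // (mulmxA B) BA mul1mx.
Qed.

Lemma strip_action1 m : strip_action m 1 1%:M%R.
Proof. by split=> v; rewrite ?invg1 act1 !mul1mx. Qed.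

Lemma act_pure_eq1 m x : m < n -> generated (pure_sub s m) x ->
  act x *m X m = X m -> x = 1.
Proof.
move=> mn Ux xX; pose a j := pure_gen s j m.
have [] := @magnus_faithful n G a m (strip_action m) (ltnW mn) _
  (strip_action1 m) (@strip_actionM m) _ _ m x (leqnn m) Ux.
- by move=> i g; apply: pureJ.
- by move=> y A B yA _; apply: strip_actionV.
- by move=> i im; apply: strip_action_gen.
move=> T [[_ xT] _]; apply; have := xT _ (has_letter_X (k := m)).
by rewrite xX strip_X.
Qed.

Lemma act_eq1 m x : m < n -> generated (braid_sub s m) x -> act x = 1%:M%R -> x = 1.
Proof.
elim: m x => [|m IHm] x mn Bx x1.
  by elim: Bx {x1} => {x} [x []//||x y _ -> _ ->|x _ ->]; rewrite ?mulg1 ?invg1.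
have mn' : m.+1 <= n.-1 by lia.
have [u [h [j [Uu Bh jm E]]]] := braid_coset braid_adj braid_far mn' Bx.
have uX : act u *m X m.+1 = X j.
  by rewrite -[RHS]mul1mx -x1 E !actM -!mulmxA act_descent // (act_low mn Bh).
have ej : j = m.+1.
  have uL : keeps_letters f u.
    by apply: generated_keeps_letters Uu => _ [i im ->]; apply: pure_gen_keeps_letters.
  have [+ _] := uL _ _ (has_letter_X (k := m.+1)).
  rewrite uX => /(_ [:: j]); rewrite inE wcoef_monomial ?eqxx; last by apply: reduced1; lia.
  by have [//|_ /(_ isT)] := eqVneq m.+1 j.
move: E uX; rewrite ej descent_nn mulg1 => E /(act_pure_eq1 mn Uu) u1.
by move: E; rewrite u1 mul1g => xh; rewrite xh; apply: (IHm _ (ltnW mn) Bh); rewrite -xh.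
Qed.

End Faithful.

Lemma free_generated (I : choiceType) (x : free_group I) :
  generated (fun y => exists i, y = free_gen i) x.
Proof.
rewrite -[x]reprK; elim: (repr x) => [|[i b] w IHw]; first exact: Gen1.
rewrite -cat1s -(free_mulE [:: (i, b)]); apply: GenM => //.
have gi : generated (fun y => exists i, y = free_gen i) (free_gen i).
  by apply: GenIn; exists i.
case: b => //; rewrite (_ : \pi_(free_group I) _ = (free_gen i)^-1); first exact: GenV.
exact/esym/free_invE.
Qed.

Section Representation.
Variable n : nat.

Lemma sigma_op_unitmx i : i.+1 < n -> sigma_op n i \in unitmx.
Proof. by move=> lti; have [] := mulmx1_unit (sigma_op_sigma_opV lti). Qed.

Definition gl_sigma (i : 'I_n.-1) : GLmatrix (dim n) int :=
  insubd (1 : GLmatrix (dim n) int) (sigma_op n i).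

Lemma gl_sigmaE i : GLmx (gl_sigma i) = sigma_op n i.
Proof. by rewrite val_insubd sigma_op_unitmx //; have := ltn_ord i; lia. Qed.

Lemma GL_inj (x y : GLmatrix (dim n) int) : GLmx x = GLmx y -> x = y.
Proof. exact: val_inj. Qed.

Lemma free_rep_relator x : braid_relator x -> free_lift gl_sigma x = 1.
Proof.
case=> i j ij; apply/eqP; rewrite gmulfM gmulfV divg_eq1 !gmulfM /= !free_lift_gen;
  apply/eqP/GL_inj; rewrite /= !gl_sigmaE.
- rewrite ij -!mulmxA sigma_op_braid //; have := ltn_ord j; lia.
- have := ltn_ord i; have := ltn_ord j; case/orP: ij => ij jn jm.
  + by rewrite sigma_op_far //; lia.
  + by rewrite [RHS]sigma_op_far //; lia.
Qed.

Definition braid_rep : UMagmaMorphism.type (braid_group n) (GLmatrix (dim n) int) :=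
  quo_lift free_rep_relator.

Lemma braid_repE x : braid_rep (quo_proj _ x) = free_lift gl_sigma x.
Proof. exact: quo_liftE. Qed.

Lemma sigmaE i (lti : i < n.-1) :
  sigma n i = quo_proj (@braid_relator n) (free_gen (Ordinal lti)).
Proof. by rewrite /sigma insubT. Qed.

Lemma braid_rep_sigma i : i.+1 < n -> GLmx (braid_rep (sigma n i)) = sigma_op n i.
Proof.
move=> lti; have lti' : i < n.-1 by lia.
by rewrite (sigmaE lti') braid_repE free_lift_gen gl_sigmaE.
Qed.

Lemma homotopy_rep_relator x : homotopy_relator x -> braid_rep x = 1.
Proof.
case=> i k g ik Ug; have kn := ltn_ord k.
have Lx : links braid_rep i k (braid_a i k) := pure_gen_links braid_rep_sigma ik kn.
have Lg : keeps_letters braid_rep g.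
  apply: generated_keeps_letters Ug => _ [j jk ->].
  exact: (pure_gen_keeps_letters braid_rep_sigma jk kn).
have xx := GL_inj (links_commute Lx (linksJ Lg Lx)).
by rewrite gmulfR; apply/eqP/commgP; rewrite /commute -!gmulfM.
Qed.

Definition homotopy_rep :
    UMagmaMorphism.type (homotopy_braid_group n) (GLmatrix (dim n) int) :=
  quo_lift homotopy_rep_relator.

Lemma homotopy_repE x : homotopy_rep (quo_proj _ x) = braid_rep x.
Proof. exact: quo_liftE. Qed.

Definition hsigma i : homotopy_braid_group n :=
  quo_proj (@homotopy_relator n) (sigma n i).

Lemma homotopy_rep_sigma i : i.+1 < n -> GLmx (homotopy_rep (hsigma i)) = sigma_op n i.
Proof. by move=> lti; rewrite homotopy_repE braid_rep_sigma. Qed.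

Lemma sigma_braid i : i.+1 < n.-1 ->
  sigma n i * sigma n i.+1 * sigma n i = sigma n i.+1 * sigma n i * sigma n i.+1.
Proof.
move=> lti; rewrite (sigmaE lti) (sigmaE (ltnW lti)) -!gmulfM.
apply/eqP; rewrite -divg_eq1 -gmulfF; apply/eqP/quo_proj_eq1.
exact: BraidAdjacent.
Qed.

Lemma sigma_far i j : i.+1 < j -> j < n.-1 -> commute (sigma n i) (sigma n j).
Proof.
move=> ij lj; have li : i < n.-1 by lia.
rewrite /commute (sigmaE li) (sigmaE lj) -!gmulfM.
apply/eqP; rewrite -divg_eq1 -gmulfF; apply/eqP/quo_proj_eq1.
by apply: BraidFar; rewrite /= ij.
Qed.

Lemma generated_sigma x : generated (braid_sub (sigma n) n.-1) x.
Proof.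
rewrite -[x]quo_proj_repr; elim: (free_generated (repr x)) => {x}.
- move=> _ [i ->]; apply: GenIn; exists i => //.
  by rewrite (sigmaE (ltn_ord i)); congr (quo_proj _ (free_gen _)); apply: val_inj.
- rewrite gmulf1; exact: Gen1.
- move=> y z _ + _; rewrite gmulfM; exact: GenM.
- move=> y _; rewrite gmulfV; exact: GenV.
Qed.

Lemma generated_hsigma x : generated (braid_sub hsigma n.-1) x.
Proof.
rewrite -[x]quo_proj_repr.
elim: (generated_sigma (repr x)) => {x} [_ [i im ->]||x y _ IHx _ IHy|x _ IHx].
- by apply: GenIn; exists i.
- rewrite gmulf1; exact: Gen1.
- rewrite gmulfM; exact: GenM.
- rewrite gmulfV; exact: GenV.
Qed.

Lemma pure_gen_hsigma j m :
  pure_gen hsigma j m = quo_proj (@homotopy_relator n) (pure_gen (sigma n) j m).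
Proof.
have dE i : descent hsigma m i = quo_proj (@homotopy_relator n) (descent (sigma n) m i).
  by rewrite /descent gmulf_prod.
by rewrite /pure_gen !dE -[hsigma j]/(quo_proj _ _) -gmulfXn -gmulfM -gmulfF.
Qed.

Lemma hsigma_pureJ m i g : m < n -> i < m -> generated (pure_sub hsigma m) g ->
  commute (pure_gen hsigma i m) (pure_gen hsigma i m ^ g).
Proof.
move=> mn im Ug.
have [h Uh ->] : exists2 h, generated (pure_sub (sigma n) m) h &
    g = quo_proj (@homotopy_relator n) h.
  elim: Ug => {g} [_ [j jm ->]||x y _ [h Uh ->] _ [k Uk ->]|x _ [h Uh ->]].
  - exists (pure_gen (sigma n) j m); last exact: pure_gen_hsigma.
    by apply: GenIn; exists j.
  - by exists 1; [apply: Gen1|rewrite gmulf1].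
  - by exists (h * k); [apply: GenM|rewrite gmulfM].
  - by exists h^-1; [apply: GenV|rewrite gmulfV].
apply/commgP/eqP; rewrite !pure_gen_hsigma -gmulfJ -gmulfR; apply: quo_proj_eq1.
have im' : i < n by apply: ltn_trans mn.
apply: (@HomotopyRelator n (Ordinal im') (Ordinal mn)) => //.
apply: generatedW Uh => _ [j jm ->].
by exists (Ordinal (ltn_trans jm mn)).
Qed.

Lemma homotopy_rep_inj : 0 < n -> injective homotopy_rep.
Proof.
move=> n_gt0; apply: gmulf_inj => x x1.
apply: (@act_eq1 n _ homotopy_rep hsigma _ _ _ _ n.-1).
- exact: homotopy_rep_sigma.
- by move=> i li; rewrite /hsigma -!gmulfM sigma_braid.
- by move=> i j ij lj; apply: gmulf_commute; apply: sigma_far.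
- exact: hsigma_pureJ.
- by rewrite prednK.
- exact: generated_hsigma.
- by rewrite /act x1.
Qed.

End Representation.

Section RationalMatrices.
Variable m : nat.

Lemma GLrat_subproof (A : GLmatrix m int) :
  (map_mx intr (GLmx A) : 'M[rat]_m) \in unitmx.
Proof.
have [] // := @mulmx1_unit _ _ (map_mx intr (GLmx A) : 'M[rat]_m)
  (map_mx intr (invmx (GLmx A))).
by rewrite -map_mxM mulmxV ?GLmxP // map_mx1.
Qed.

Definition GLrat (A : GLmatrix m int) : GLmatrix m rat := GLMatrix (GLrat_subproof A).

Lemma GLratM : {morph GLrat : A B / A * B}.
Proof. by move=> A B; apply: val_inj; rewrite /= map_mxM. Qed.

HB.instance Definition _ := isMultiplicative.Build _ _ GLrat GLratM.

Lemma GLrat_inj : injective GLrat.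
Proof.
move=> A B /(congr1 (@GLmx _ _)) /matrixP AB; apply/val_inj/matrixP => i j.
by have := AB i j; rewrite !mxE => /intr_inj.
Qed.

End RationalMatrices.

Theorem theorem3p1 :
  (forall n : nat, 2 <= n -> linear_group (homotopy_braid_group n)) /\
  (forall n : nat, 2 <= n ->
     exists (m : nat)
       (rho : {multiplicative homotopy_braid_group n -> GLmatrix m int}),
       injective rho).
Proof.
split=> n /ltnW n_gt0; last first.
  by exists (dim n), (homotopy_rep n); apply: homotopy_rep_inj.
exists (dim n), rat, (@GLrat (dim n) \o homotopy_rep n).
exact: inj_comp (@GLrat_inj _) (homotopy_rep_inj n_gt0).
Qed.
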